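(* Let $f_0:\mathbb R\to[0,\infty)$ be a two-peaked distribution function with maxima at $a$ and $b$ and minimum at $c$ as described in the context, let $\varphi=f_0'$, and let $k\in\mathbb R\setminus\{0\}$ be such that every zero $s$ of $\varphi$ satisfies $1-\frac1{k^2}\int_{-\infty}^{\infty}\frac{\varphi(v)}{v-s}\,dv\ne 0$. If there exist $\sigma\in(0,c-a)$ and $\tau\in(0,b-c)$ such that $$\frac{\sigma\,f_0(a+\sigma)}{(c-a-\sigma)(c-a)}+\frac{\tau\,f_0(b-\tau)}{(b-c-\tau)(b-c)}\ >\ k^2 ,$$ then the right half-plane $\mathrm{Re}\,\lambda>0$ contains exactly one singular value corresponding to $k$, i.e. exactly one $\lambda$ with $\mathrm{Re}\,\lambda>0$ and $\Delta(k,\lambda)=0$.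
   Context: Assumptions on $f_0$: $f_0$ is twice differentiable, $f_0(v)\to 0$ as $v\to\pm\infty$, and $\varphi:=f_0'$ satisfies $\varphi\in L_1(\mathbb R)$, $\varphi(v)\to0$ as $v\to\pm\infty$, $\varphi'$ is bounded, and every zero $s$ of $\varphi$ is non-degenerate ($\varphi'(s)\neq0$). There are points $a<c<b$ and $M>0$ with $f_0(a)=f_0(b)=M$, $f_0(c)=0$, $\varphi(a)=\varphi(b)=\varphi(c)=0$, $\varphi(v)>0$ for $v\in(-\infty,a)\cup(c,b)$ and $\varphi(v)<0$ for $v\in(a,c)\cup(b,\infty)$. Notation: for $k\ne0$ and $\lambda\in\mathbb C\setminus i\mathbb R$, $$\Delta(k,\lambda)=1+\frac1{ik}\int_{-\infty}^{\infty}\frac{\varphi(v)}{ikv+\lambda}\,dv .$$ *)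

(* Defs.v *)
From HB Require Import structures.
From mathcomp Require Import all_boot all_order all_algebra.
From mathcomp Require Import complex.
From mathcomp Require Import all_classical all_reals all_analysis.

Set Implicit Arguments.
Unset Strict Implicit.
Unset Printing Implicit Defensive.

Import Order.TTheory GRing.Theory Num.Theory.
Import numFieldNormedType.Exports.

Local Open Scope ring_scope.
Local Open Scope classical_set_scope.
Local Open Scope complex_scope.

Record regular_profile (R : realType) (f : R -> R) : Prop := RegularProfile {
  profile_ge0 : forall v, 0 <= f v;
  profile_derivable : forall v, derivable f v 1;
  profile_derivable2 : forall v, derivable f^`() v 1;
  profile_cvgNy : f x @[x --> -oo] --> (0 : R);
  profile_cvgy : f x @[x --> +oo] --> (0 : R);
  profile'_L1 : lebesgue_measure.-integrable setT (EFin \o f^`());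
  profile'_cvgNy : f^`() x @[x --> -oo] --> (0 : R);
  profile'_cvgy : f^`() x @[x --> +oo] --> (0 : R);
  profile''_bounded : bounded_fun (f^`()^`());
  profile'_nondegenerate : forall s, f^`() s = 0 -> f^`()^`() s != 0
}.

Record two_peaked (R : realType) (f : R -> R) (a b c M : R) : Prop :=
    TwoPeaked {
  peaks_ac : a < c;
  peaks_cb : c < b;
  peaks_M : 0 < M;
  peaks_fa : f a = M;
  peaks_fb : f b = M;
  peaks_fc : f c = 0;
  peaks_f'a : f^`() a = 0;
  peaks_f'b : f^`() b = 0;
  peaks_f'c : f^`() c = 0;
  peaks_pos : forall v, v < a \/ c < v < b -> 0 < f^`() v;
  peaks_neg : forall v, a < v < c \/ b < v -> f^`() v < 0
}.

(* Lebesgue integral over the line of a complex-valued function, taken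
   componentwise. *)
Definition cintegral (R : realType) (g : R -> R[i]) : R[i] :=
  (\int[lebesgue_measure]_v complex.Re (g v)) +i*
  (\int[lebesgue_measure]_v complex.Im (g v)).

(* Meaningful for k != 0 and Re l != 0: the denominator i k v + l then
   vanishes for no real v. *)
Definition Delta (R : realType) (phi : R -> R) (k : R) (l : R[i]) : R[i] :=
  1 + ('i%C * k%:C)^-1 *
      cintegral (fun v : R => (phi v)%:C / ('i%C * k%:C * v%:C + l)).

(* Used only at zeros s of a phi with bounded derivative, where the integrand
   is bounded near s: no principal value is involved, and the value
   phi s / 0 = 0 taken at the single point v = s does not matter. *)
Definition real_dispersion (R : realType) (phi : R -> R) (k s : R) : R :=
  1 - (k ^+ 2)^-1 * \int[lebesgue_measure]_v (phi v / (v - s)).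

(* Main.v *)
Require Import Defs.
From mathcomp Require Import all_boot all_order all_algebra.
From mathcomp Require Import complex.
From mathcomp Require Import all_classical all_reals all_analysis.
From mathcomp Require Import measurable_realfun.
From mathcomp Require Import ring lra.
Set Implicit Arguments.
Unset Strict Implicit.
Unset Printing Implicit Defensive.
Import Order.TTheory GRing.Theory Num.Theory.
Import numFieldNormedType.Exports.
Local Open Scope ring_scope.
Local Open Scope classical_set_scope.
Local Open Scope complex_scope.

(* For lambda = x + i y with x > 0, Delta(k, lambda) = 0 means that the positive
   quadratic p(v) = x^2 + (k v + y)^2 satisfies int phi / p = 0 and
   int v phi / p = 1.

   Uniqueness: if p and q are two solutions, then q - p is affine, and taking
   differences of the equations shows that phi / (p q) is orthogonal to 1, v and
   v^2, whereas its integral against v^3 is 1 / k^2.  This contradicts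
   phi(v) (v - a) (v - c) (v - b) <= 0.

   Existence: the upper half-plane of roots is foliated by the half-circles of
   Apollonius of a and b, indexed by their foot m in ]a, b[.  Along each of them
   two polynomials differ by a multiple of (v - a) (v - b), so the normalized
   integral of phi(v) (v - c) / p decreases, by the same sign condition, and it
   crosses k^2: near the endpoint m it blows up, or for m = c it exceeds k^2 by
   the hypothesis on sigma and tau, and near the other endpoint it is too small.
   The crossing point depends continuously on m, and on the resulting curve
   int phi / p is negative for m near a and positive for m near b. *)

(** * Integrals of an integrable density against bounded weights *)

Section weighted_integral.
Context {R : realType}.
Local Notation mu := (@lebesgue_measure R).

(** These weights keep the product with any integrable density integrable. *)
Definition tame (w : R -> R) :=
  measurable_fun setT w /\ exists C, forall v, `|w v| <= C.

Lemma tameD w1 w2 : tame w1 -> tame w2 -> tame (fun v => w1 v + w2 v).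
Proof.
move=> [m1 [C1 h1]] [m2 [C2 h2]]; split; first exact: measurable_funD.
by exists (C1 + C2) => v; rewrite (le_trans (ler_normD _ _))// lerD.
Qed.

Lemma tameZ x w : tame w -> tame (fun v => x * w v).
Proof.
move=> [m1 [C1 h1]]; split; first exact: measurable_funM.
by exists (`|x| * C1) => v; rewrite normrM ler_wpM2l.
Qed.

Lemma tameN w : tame w -> tame (fun v => - w v).
Proof.
by move=> tw; under eq_fun do rewrite -mulN1r; exact: tameZ.
Qed.

Lemma tameB w1 w2 : tame w1 -> tame w2 -> tame (fun v => w1 v - w2 v).
Proof. by move=> t1 t2; apply: tameD => //; exact: tameN. Qed.

Lemma tame_cst x : tame (fun=> x).
Proof. by split; [exact: measurable_cst | exists `|x|]. Qed.

Lemma tameM w1 w2 : tame w1 -> tame w2 -> tame (fun v => w1 v * w2 v).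
Proof.
move=> [m1 [C1 h1]] [m2 [C2 h2]]; split; first exact: measurable_funM.
by exists (C1 * C2) => v; rewrite normrM ler_pM.
Qed.

(** In [v] this steps down from 1 to 0 just after [x], the reverse of the usual orientation, so that
    pairing it with a derivative integrates from minus infinity up to [x]. *)
Definition heaviside (x v : R) : R := (v <= x)%R%:R.

Lemma heavisideE x : heaviside x = \1_(`]-oo, x]).
Proof.
apply/funext => v; rewrite /heaviside indicE; congr (nat_of_bool _)%:R.
by rewrite mem_setE in_itv.
Qed.

Lemma tame_heaviside x : tame (heaviside x).
Proof.
split; first by rewrite heavisideE; exact: measurable_indic.
by exists 1 => v; rewrite /heaviside; case: (v <= x) => /=; rewrite ?normr1 ?normr0.
Qed.

Variable phi : R -> R.
Hypothesis phi_int : mu.-integrable setT (EFin \o phi).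

Definition wint (w : R -> R) : R := \int[mu]_v (phi v * w v).

Lemma integrable_tame w : tame w ->
  mu.-integrable setT (EFin \o (fun v => phi v * w v)).
Proof.
move=> [mw [C hC]].
have : mu.-integrable setT ((EFin \o phi) \* (EFin \o w))%E.
  apply: integrableMl => //.
  exists C; split; first exact: num_real.
  by move=> x Cx v _ /=; rewrite (le_trans (hC v))// ltW.
by apply: eq_integrable.
Qed.

Lemma wintD w1 w2 : tame w1 -> tame w2 ->
  wint (fun v => w1 v + w2 v) = wint w1 + wint w2.
Proof.
move=> t1 t2; rewrite /wint -RintegralD//; try exact: integrable_tame.
by apply: eq_Rintegral => v _; rewrite mulrDr.
Qed.

Lemma wintB w1 w2 : tame w1 -> tame w2 ->
  wint (fun v => w1 v - w2 v) = wint w1 - wint w2.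
Proof.
move=> t1 t2; rewrite /wint -RintegralB//; try exact: integrable_tame.
by apply: eq_Rintegral => v _; rewrite mulrBr.
Qed.

Lemma wintZ x w : tame w -> wint (fun v => x * w v) = x * wint w.
Proof.
move=> t1; rewrite /wint -RintegralZl//; try exact: integrable_tame.
by apply: eq_Rintegral => v _; rewrite mulrCA.
Qed.

Lemma eq_wint w1 w2 : w1 =1 w2 -> wint w1 = wint w2.
Proof. by move=> h; apply: eq_Rintegral => v _; rewrite h. Qed.

Lemma le_wint w1 w2 : tame w1 -> tame w2 ->
  (forall v, phi v * w1 v <= phi v * w2 v) -> wint w1 <= wint w2.
Proof. by move=> t1 t2 h; apply: le_Rintegral => //; exact: integrable_tame. Qed.

Definition mass : R := \int[mu]_v `|phi v|.

Lemma mass_ge0 : 0 <= mass.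
Proof. exact: Rintegral_ge0. Qed.

Lemma integrable_absdensity : mu.-integrable setT (EFin \o (fun v => `|phi v|)).
Proof. exact: integrable_norm. Qed.

Lemma wint_bound C w : tame w -> (forall v, `|w v| <= C) -> `|wint w| <= C * mass.
Proof.
move=> tw hw; rewrite /wint /mass -RintegralZl//; last exact: integrable_absdensity.
apply: le_trans; first by apply: le_normr_Rintegral => //; exact: integrable_tame.
apply: le_Rintegral => //.
- by apply: (@integrable_norm _ _ _ mu setT (fun v => phi v * w v)); exact: integrable_tame.
- have := integrableZl measurableT C integrable_absdensity.
  by apply: eq_integrable.
- by move=> v _; rewrite normrM mulrC ler_wpM2r.
Qed.

Lemma le_wint_spike C kappa x h w : tame w -> 0 <= h ->
  (forall v, kappa * (heaviside (x + h) v - heaviside x v) - C * `|phi v|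
             <= phi v * w v) ->
  kappa * h - C * mass <= wint w.
Proof.
move=> tw h0 hw.
have iv : mu.-integrable setT
    (EFin \o (fun v => kappa * (heaviside (x + h) v - heaviside x v))).
  have : mu.-integrable setT (EFin \o (fun v => \1_(`]x, (x + h)]) v : R)).
    exact: integrable_indic_itv.
  move=> /(integrableZl measurableT kappa); apply: eq_integrable => // v _ /=.
  rewrite -EFinM indicE mem_setE in_itv/= /heaviside.
  congr (_ * _)%:E; have [vx|vx] := leP v x => /=; last by rewrite subr0.
  by rewrite (le_trans vx) ?lerDl// subrr.
have ip : mu.-integrable setT (EFin \o (fun v => C * `|phi v|)).
  have := integrableZl measurableT C integrable_absdensity.
  by apply: eq_integrable.
have <- : \int[mu]_v (kappa * (heaviside (x + h) v - heaviside x v) - C * `|phi v|)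
    = kappa * h - C * mass.
  rewrite RintegralB//; congr (_ - _); last by rewrite RintegralZl// integrable_absdensity.
  transitivity (\int[mu]_(v in `]x, (x + h)]) kappa).
    rewrite [RHS]Rintegral_mkcond; apply: eq_Rintegral => v _.
    rewrite patchE mem_setE in_itv/= /heaviside.
    have [vx|vx] := leP v x => /=.
      by rewrite (le_trans vx) ?lerDl// subrr mulr0.
    by rewrite subr0; case: (v <= x + h); rewrite ?mulr1 ?mulr0.
  rewrite Rintegral_cst//= lebesgue_measure_itv/= lte_fin.
  case: ltP => [_|]; first by rewrite -EFinD/= addrC addKr.
  by rewrite gerDl => h1; rewrite (@le_anti _ _ h 0) ?h0 ?h1.
apply: le_Rintegral => //; last exact: integrable_tame.
have := integrableB measurableT iv ip.
by apply: eq_integrable.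
Qed.

(** Serves to make an integral large: a spike contributes its area [kappa h], while the rest costs
    at most a fixed multiple of [mass]. *)
Lemma spike_le_wint C kappa x h w : tame w -> 0 <= h -> 0 <= C ->
  (forall v, x < v <= x + h -> kappa <= phi v * w v) ->
  (forall v, - (C * `|phi v|) <= phi v * w v) ->
  kappa * h - C * mass <= wint w.
Proof.
move=> tw h0 C0 hk hC; apply: (le_wint_spike (x := x)) => // v.
have Cp : 0 <= C * `|phi v| by rewrite mulr_ge0.
rewrite /heaviside; have [vx|xv] := leP v x => /=.
  by rewrite (le_trans vx) ?lerDl// subrr mulr0 sub0r.
have [vxh|_] := leP v (x + h); last by rewrite subrr mulr0 sub0r.
rewrite subr0 mulr1 (@le_trans _ _ kappa) ?hk ?xv//.
by rewrite gerBl.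
Qed.

Lemma wint_dominated (w_ : nat -> R -> R) w : (forall n, tame (w_ n)) -> tame w ->
  (exists C, forall n v, `|w_ n v| <= C) ->
  (forall v, (fun n => w_ n v) @ \oo --> w v) ->
  (fun n => wint (w_ n)) @ \oo --> wint w.
Proof.
move=> tw_ tw [C hC] hw.
have [] := @dominated_convergence _ _ _ mu setT measurableT
  (fun n => EFin \o (fun v => phi v * w_ n v)) (EFin \o (fun v => phi v * w v))
  (EFin \o (fun v => C * `|phi v|)).
- by move=> n; exact: (measurable_int mu (integrable_tame (tw_ n))).
- exact: (measurable_int mu (integrable_tame tw)).
- apply: aeW => v _ /=; apply: cvg_EFin; first exact: nearW.
  by apply: cvgM; [exact: cvg_cst | exact: hw].
- have := integrableZl measurableT C integrable_absdensity.
  by apply: eq_integrable.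
- by apply: aeW => v n _ /=; rewrite lee_fin normrM mulrC ler_wpM2r.
move=> _ _ h; apply: fine_cvg => /=.
rewrite fineK; first exact: h.
exact: integrable_fin_num (integrable_tame tw).
Qed.

End weighted_integral.

(** * Recovering a function on the line from its derivative *)

Section primitive.
Context {R : realType}.
Local Notation mu := (@lebesgue_measure R).
Variable f : R -> R.
Hypothesis f_derivable : forall v, derivable f v 1.
Hypothesis f'_continuous : continuous (derive1 f).
Hypothesis f_Ny : f x @[x --> -oo] --> (0 : R).
Hypothesis f_y : f x @[x --> +oo] --> (0 : R).
Hypothesis f'_int : mu.-integrable setT (EFin \o (derive1 f)).

Lemma wint_heavisideB x y : x < y ->
  wint (derive1 f) (fun v => heaviside y v - heaviside x v) = f y - f x.
Proof.
move=> xy.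
have fc : continuous f.
  by move=> v; apply: differentiable_continuous; exact/derivable1_diffP.
have h : (\int[mu]_(v in `[x, y]) (derive1 f v)%:E = (f y)%:E - (f x)%:E)%E.
  apply: (@continuous_FTC2 R (derive1 f) f x y xy).
  - exact: continuous_subspaceT.
  - split; [by move=> v _ | apply: cvg_at_right_filter; exact: fc |].
    apply: cvg_at_left_filter; exact: fc.
  - by [].
transitivity (\int[mu]_(v in `]x, y]) derive1 f v).
  rewrite [RHS]Rintegral_mkcond; apply: eq_Rintegral => v _.
  rewrite patchE mem_setE in_itv/= /heaviside.
  have [vx|vx] := leP v x => /=.
    by rewrite (le_trans vx (ltW xy)) subrr mulr0.
  by rewrite subr0; case: (v <= y); rewrite ?mulr1 ?mulr0.
transitivity (\int[mu]_(v in `[x, y]) derive1 f v); last exact: (congr1 fine h).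
apply: (@Rintegral_itv_obnd_cbnd R x (BRight y) (derive1 f)).
by apply: integrableS f'_int.
Qed.

Lemma heaviside_cvg_Ny v : (fun n : nat => heaviside (- n%:R) v) @ \oo --> (0 : R).
Proof.
apply: cvg_near_cst; exists (Num.truncn (`|v|)).+1 => //= n /= hn.
rewrite /heaviside leNgt (_ : _ < v) //.
have : `|v| < n%:R by rewrite (lt_le_trans (truncnS_gt _))// ler_nat.
by rewrite ltr_norml => /andP[].
Qed.

Lemma heaviside_cvg_y v : (fun n : nat => heaviside n%:R v) @ \oo --> (1 : R).
Proof.
apply: cvg_near_cst; exists (Num.truncn (`|v|)).+1 => //= n /= hn.
rewrite /heaviside (_ : v <= _) //.
have : `|v| < n%:R by rewrite (lt_le_trans (truncnS_gt _))// ler_nat.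
by rewrite ltr_norml => /andP[_ /ltW].
Qed.

(** The lower threshold in [wint_heavisideB] is sent to minus infinity: dominated convergence
    handles the integral, and the decay of [f] removes the boundary term. *)
Lemma wint_heaviside x : wint (derive1 f) (heaviside x) = f x.
Proof.
have h1 : (fun n : nat => wint (derive1 f) (fun v => heaviside x v - heaviside (- n%:R) v))
   @ \oo --> wint (derive1 f) (heaviside x).
  apply: wint_dominated => //.
  - by move=> n; apply: tameB; exact: tame_heaviside.
  - exact: tame_heaviside.
  - exists 2 => n v; rewrite /heaviside.
    by case: (v <= x); case: (v <= _) => /=;
      rewrite ?subrr ?subr0 ?sub0r ?normrN ?normr0 ?normr1 ?ler1n.
  - move=> v; rewrite -[X in _ --> X]subr0.
    by apply: cvgB; [exact: cvg_cst | exact: heaviside_cvg_Ny].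
have h2 : (fun n : nat => f x - f (- n%:R)) @ \oo --> f x - 0.
  apply: cvgB; first exact: cvg_cst.
  apply: (cvg_comp (fun n : nat => - n%:R) f); last exact: f_Ny.
  by apply/cvgNry; rewrite [X in X @ _ --> _](_ : _ = fun n : nat => n%:R);
    [exact: cvgr_idn | apply/funext => n /=; rewrite opprK].
rewrite subr0 in h2.
apply: (cvg_unique (@Rhausdorff R) h1).
apply: cvg_trans h2; apply: near_eq_cvg.
exists (Num.truncn (`|x|)).+1 => //= n /= hn.
rewrite wint_heavisideB //.
have : `|x| < n%:R by rewrite (lt_le_trans (truncnS_gt _))// ler_nat.
by rewrite ltr_norml => /andP[].
Qed.

(** The threshold in [wint_heaviside] is sent to plus infinity, where [f] tends to 0 as well. *)
Lemma wint_cst : wint (derive1 f) (fun=> 1) = 0.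
Proof.
have h1 : (fun n : nat => wint (derive1 f) (heaviside n%:R))
   @ \oo --> wint (derive1 f) (fun=> 1).
  apply: wint_dominated => //.
  - by move=> n; exact: tame_heaviside.
  - exact: tame_cst.
  - exists 1 => n v; rewrite /heaviside.
    by case: (v <= _) => /=; rewrite ?normr0 ?normr1.
  - by move=> v; exact: heaviside_cvg_y.
have h2 : (fun n : nat => f n%:R) @ \oo --> (0 : R).
  apply: (cvg_comp (fun n : nat => n%:R) f); last exact: f_y.
  exact: cvgr_idn.
apply: (cvg_unique (@Rhausdorff R) h1).
rewrite (_ : (fun n : nat => _) = fun n : nat => f n%:R)//.
by apply/funext => n; rewrite wint_heaviside.
Qed.

End primitive.

(** * Step functions and Abel summation *)

Section step_functions.
Context {R : realType}.
Local Notation mu := (@lebesgue_measure R).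
Variables phi f : R -> R.
Hypothesis phi_int : mu.-integrable setT (EFin \o phi).
Hypothesis wint_phi_heaviside : forall x, wint phi (heaviside x) = f x.
Hypothesis wint_phi_cst : wint phi (fun=> 1) = 0.
Implicit Type s : seq (R * R).

(* The value k applies up to the first threshold, and the second component of
   each pair applies from its threshold on. *)
Fixpoint step k s (v : R) : R :=
  if s is (x, k') :: s' then if v <= x then k else step k' s' v else k.

(** Abel summation: each jump is weighted by the primitive [f] at its threshold. The last value
    leaves no term because [phi] has total integral 0. *)
Fixpoint step_sum k s : R :=
  if s is (x, k') :: s' then (k - k') * f x + step_sum k' s' else 0.

Lemma step_below k s v : all (fun p => v <= p.1) s -> step k s v = k.
Proof. by case: s => [|[x k'] s]//= /andP[->]. Qed.

Lemma step_tame_wint k s : sorted <=%R (unzip1 s) ->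
  tame (step k s) /\ wint phi (step k s) = step_sum k s.
Proof.
elim: s k => [|[x k'] s IH] k /=.
  move=> _; split; first exact: tame_cst.
  have := wintZ phi_int k (tame_cst 1); rewrite wint_phi_cst mulr0 => <-.
  by apply: eq_wint => v; rewrite mulr1.
move=> xs; have [t h] := IH k' (path_sorted xs).
(* The first jump is split off as a Heaviside function. The remaining step function must then equal
   [k'] up to [x], which is where sortedness enters. *)
have -> : (fun v => if v <= x then k else step k' s v) =
    (fun v => (k - k') * heaviside x v + step k' s v).
  apply/funext => v; rewrite /heaviside; case: leP => vx /=.
    rewrite mulr1 step_below ?subrK//.
    have := order_path_min le_trans xs; rewrite all_map.
    by apply: sub_all => p /= xp; exact: le_trans xp.
  by rewrite mulr0 add0r.
have th := tameZ (k - k') (tame_heaviside x).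
split; first exact: tameD.
by rewrite wintD// h wintZ ?wint_phi_heaviside//; exact: tame_heaviside.
Qed.

Lemma step_le_wint k s w : sorted <=%R (unzip1 s) -> tame w ->
  (forall v, phi v * step k s v <= phi v * w v) -> step_sum k s <= wint phi w.
Proof. by move=> /(step_tame_wint k)[t <-] tw h; exact: le_wint. Qed.

Lemma wint_le_step k s w : sorted <=%R (unzip1 s) -> tame w ->
  (forall v, phi v * w v <= phi v * step k s v) -> wint phi w <= step_sum k s.
Proof. by move=> /(step_tame_wint k)[t <-] tw h; exact: le_wint. Qed.

End step_functions.

(** * Integrals against affine over quadratic functions, and their continuity in the coefficients *)

Section quadratic_weights.
Context {R : realType}.
Local Notation mu := (@lebesgue_measure R).
Implicit Types s A B C al be v : R.

Definition quad A B C v : R := A * v ^+ 2 + B * v + C.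

Definition posquad A B C := 0 < A /\ B ^+ 2 < 4 * A * C.

Definition ratio al be A B C v : R := (al * v + be) / quad A B C v.

(* The smallest eigenvalue of the quadratic form is at least its determinant
   divided by its trace. *)
Definition quadmin A B C : R := (A * C - B ^+ 2 / 4) / (A + C).

Lemma posquad_C A B C : posquad A B C -> 0 < C.
Proof.
move=> [A0 D]; have : 0 < 4 * A * C by apply: le_lt_trans D; exact: sqr_ge0.
by rewrite pmulr_rgt0 // mulr_gt0.
Qed.

Lemma quadmin_gt0 A B C : posquad A B C -> 0 < quadmin A B C.
Proof.
move=> h; have C0 := posquad_C h; case: h => A0 D.
by apply: divr_gt0; [lra | exact: addr_gt0].
Qed.

(** By Cayley-Hamilton, the trace times the form minus the determinant times [1 + v ^+ 2] is the
    squared norm of the symmetric matrix applied to (v, 1), a sum of two squares. *)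
Lemma quadmin_le A B C v : posquad A B C ->
  quadmin A B C * (1 + v ^+ 2) <= quad A B C v.
Proof.
move=> h; have C0 := posquad_C h; case: h => A0 D.
rewrite /quadmin mulrAC ler_pdivrMr ?addr_gt0// -subr_ge0.
rewrite (_ : _ - _ = (A * v + B / 2) ^+ 2 + (B / 2 * v + C) ^+ 2).
  by rewrite addr_ge0// sqr_ge0.
by rewrite /quad; field.
Qed.

Lemma sqr1_gt0 v : 0 < 1 + v ^+ 2.
Proof. by rewrite ltr_pwDl// sqr_ge0. Qed.

Lemma quad_gt0 A B C v : posquad A B C -> 0 < quad A B C v.
Proof.
move=> h; apply: lt_le_trans (quadmin_le v h).
by rewrite mulr_gt0 ?quadmin_gt0 ?sqr1_gt0.
Qed.

Lemma affine_le al be v : `|al * v + be| <= (`|al| + `|be|) * (1 + v ^+ 2).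
Proof.
rewrite (le_trans (ler_normD _ _))// normrM.
have h1 : `|v| <= 1 + v ^+ 2.
  rewrite -[v ^+ 2]real_normK ?num_real//; nra.
have h2 : 1 <= 1 + v ^+ 2 by rewrite lerDl sqr_ge0.
rewrite mulrDl lerD// ?ler_wpM2l//.
by rewrite ler_peMr.
Qed.

Lemma quad_continuous A B C : continuous (quad A B C).
Proof.
move=> v; rewrite /quad; apply: cvgD; last exact: cvg_cst.
apply: cvgD; apply: cvgM; try exact: cvg_cst; try exact: cvg_id.
by apply: (@cvgM _ _ _ _ id id); exact: cvg_id.
Qed.

Lemma ratio_continuous al be A B C : posquad A B C ->
  continuous (ratio al be A B C).
Proof.
move=> h v; rewrite /ratio; apply: cvgM.
  by apply: cvgD; [apply: cvgM; [exact: cvg_cst|exact: cvg_id]|exact: cvg_cst].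
by apply: cvgV; [rewrite gt_eqF// quad_gt0 | exact: quad_continuous].
Qed.

Lemma ratio_le al be A B C v : posquad A B C ->
  `|ratio al be A B C v| <= (`|al| + `|be|) / quadmin A B C.
Proof.
move=> h; have q0 := quad_gt0 v h; have m0 := quadmin_gt0 h.
rewrite /ratio normrM normfV (gtr0_norm q0) ler_pdivrMr//.
apply: (le_trans (affine_le al be v)).
rewrite mulrAC ler_pdivlMr// -mulrA ler_wpM2l ?addr_ge0//.
by rewrite mulrC quadmin_le.
Qed.

Lemma tame_ratio al be A B C : posquad A B C -> tame (ratio al be A B C).
Proof.
move=> h; split.
  by apply: continuous_measurable_fun; exact: ratio_continuous.
by exists ((`|al| + `|be|) / quadmin A B C) => v; exact: ratio_le.
Qed.

(** The difference of the quotients has for numerator the affine function times the difference of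
    the quadratics. Both factors are O(1 + v^2), and each denominator is at least its [quadmin]
    times 1 + v^2, so the bound is uniform in [v]. *)
Lemma ratio_lip al be A B C A' B' C' v : posquad A B C -> posquad A' B' C' ->
  `|ratio al be A' B' C' v - ratio al be A B C v| <=
  (`|al| + `|be|) * (`|A' - A| + `|B' - B| + `|C' - C|) /
  (quadmin A' B' C' * quadmin A B C).
Proof.
move=> h h'; have q0 := quad_gt0 v h; have m0 := quadmin_gt0 h.
have q0' := quad_gt0 v h'; have m0' := quadmin_gt0 h'.
have -> : ratio al be A' B' C' v - ratio al be A B C v =
  - (al * v + be) * quad (A' - A) (B' - B) (C' - C) v /
    (quad A' B' C' v * quad A B C v).
  rewrite /ratio; move: q0 q0'; rewrite /quad => /lt0r_neq0 q0 /lt0r_neq0 q0'.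
  by field; rewrite q0 q0'.
rewrite normrM normfV (gtr0_norm (mulr_gt0 q0' q0)).
rewrite ler_pdivrMr; last exact: mulr_gt0.
rewrite [leRHS]mulrAC normrM normrN.
rewrite ler_pdivlMr; last exact: mulr_gt0.
have s0 := sqr1_gt0 v.
have hn := affine_le al be v.
have hd : `|quad (A' - A) (B' - B) (C' - C) v| <=
    (`|A' - A| + `|B' - B| + `|C' - C|) * (1 + v ^+ 2).
  rewrite /quad -addrA (le_trans (ler_normD _ _))//.
  have := affine_le (B' - B) (C' - C) v.
  have : `|(A' - A) * v ^+ 2| <= `|A' - A| * (1 + v ^+ 2).
    by rewrite normrM ler_wpM2l// ger0_norm ?sqr_ge0// lerDr.
  lra.
have k1 := quadmin_le v h; have k2 := quadmin_le v h'.
apply: (@le_trans _ _ (((`|al| + `|be|) * (1 + v ^+ 2)) *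
   ((`|A' - A| + `|B' - B| + `|C' - C|) * (1 + v ^+ 2)) *
   (quadmin A' B' C' * quadmin A B C))).
  by apply: ler_wpM2r; [rewrite mulr_ge0 ?ltW | exact: ler_pM].
rewrite [leLHS](_ : _ = (`|al| + `|be|) * (`|A' - A| + `|B' - B| + `|C' - C|) *
   ((quadmin A' B' C' * (1 + v ^+ 2)) * (quadmin A B C * (1 + v ^+ 2)))); last by ring.
apply: ler_wpM2l; first by rewrite mulr_ge0 ?addr_ge0.
by apply: ler_pM => //; rewrite mulr_ge0 ?ltW.
Qed.

Variable phi : R -> R.
Hypothesis phi_int : mu.-integrable setT (EFin \o phi).

Definition qint al be A B C : R := wint phi (ratio al be A B C).

Lemma qintE al be A B C : posquad A B C ->
  qint al be A B C = al * qint 1 0 A B C + be * qint 0 1 A B C.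
Proof.
move=> h; rewrite /qint -!wintZ//; try exact: tame_ratio.
rewrite -wintD//; try exact/tameZ/tame_ratio.
by apply: eq_wint => v; rewrite /ratio; ring.
Qed.

Lemma qint_scale s al be A B C : s != 0 -> posquad A B C ->
  qint al be (s * A) (s * B) (s * C) = s^-1 * qint al be A B C.
Proof.
move=> s0 h; rewrite /qint -wintZ//; last exact: tame_ratio.
apply: eq_wint => v; rewrite /ratio.
have -> : quad (s * A) (s * B) (s * C) v = s * quad A B C v.
  by rewrite /quad; ring.
by rewrite invfM mulrCA.
Qed.

Lemma qint_lip al be A B C A' B' C' : posquad A B C -> posquad A' B' C' ->
  `|qint al be A' B' C' - qint al be A B C| <=
  (`|al| + `|be|) * (`|A' - A| + `|B' - B| + `|C' - C|) /
  (quadmin A' B' C' * quadmin A B C) * mass phi.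
Proof.
move=> h h'; rewrite /qint -wintB//; try exact: tame_ratio.
apply: wint_bound => //; first by apply: tameB; exact: tame_ratio.
by move=> v; exact: ratio_lip.
Qed.

(** The condition [posquad] is open and [quadmin] is continuous, so the bound of [qint_lip]
    eventually applies and tends to 0. *)
Lemma qint_cvg {T : Type} {F : set_system T} {FF : Filter F} (a_ b_ c_ : T -> R)
    al be A B C : posquad A B C ->
  a_ @ F --> A -> b_ @ F --> B -> c_ @ F --> C ->
  (fun t => qint al be (a_ t) (b_ t) (c_ t)) @ F --> qint al be A B C.
Proof.
move=> h ha hb hc; have C0 := posquad_C h.
have pos : \forall t \near F, posquad (a_ t) (b_ t) (c_ t).
  case: (h) => A0 D.
  have near1 : \forall t \near F, 0 < a_ t by exact: (cvgr_gt A).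
  have h2 : (fun t => 4 * a_ t * c_ t - b_ t ^+ 2) @ F --> 4 * A * C - B ^+ 2.
    apply: cvgB; last by apply: (@cvgM _ _ _ _ b_ b_).
    by apply: cvgM => //; apply: cvgM => //; exact: cvg_cst.
  have near2 : \forall t \near F, 0 < 4 * a_ t * c_ t - b_ t ^+ 2.
    by apply: (cvgr_gt _ h2); rewrite subr_gt0.
  by near=> t; split; [near: t | rewrite -subr_gt0; near: t].
have hq : (fun t => quadmin (a_ t) (b_ t) (c_ t)) @ F --> quadmin A B C.
  rewrite /quadmin; apply: cvgM.
    apply: cvgB; first exact: cvgM.
    by apply: cvgM; [apply: (@cvgM _ _ _ _ b_ b_)|exact: cvg_cst].
  apply: cvgV; last exact: cvgD.
  by case: h => A0 _; rewrite gt_eqF// addr_gt0.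
pose g t := (`|al| + `|be|) * (`|a_ t - A| + `|b_ t - B| + `|c_ t - C|) /
  (quadmin (a_ t) (b_ t) (c_ t) * quadmin A B C) * mass phi.
have hg : g @ F --> (0 : R).
  have dist0 (u_ : T -> R) U : u_ @ F --> U -> (fun t => `|u_ t - U|) @ F --> (0 : R).
    move=> hu; rewrite -(@normr0 _ R); apply: cvg_norm.
    by rewrite -(subrr U); apply: cvgB => //; exact: cvg_cst.
  rewrite (_ : 0 = (`|al| + `|be|) * (0 + 0 + 0) /
    (quadmin A B C * quadmin A B C) * mass phi); last by rewrite !addr0 mulr0 !mul0r.
  apply: cvgM; last exact: cvg_cst.
  apply: cvgM.
    apply: cvgM; first exact: cvg_cst.
    by apply: cvgD; [apply: cvgD|]; exact: dist0.
  apply: cvgV; first by rewrite mulf_neq0// gt_eqF// quadmin_gt0.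
  by apply: cvgM => //; exact: cvg_cst.
apply/cvgrPdist_le => e e0.
move/cvgrPdist_le : hg => /(_ e e0) hg.
near=> t.
have ht : posquad (a_ t) (b_ t) (c_ t) by near: t.
have gt : `|0 - g t| <= e by near: t.
rewrite distrC (le_trans (qint_lip _ _ h ht))//.
by apply: le_trans gt; rewrite sub0r normrN ler_norm.
Unshelve. all: by end_near.
Qed.

End quadratic_weights.

(** * The equation [Delta = 0] in real form *)

Section dispersion_relation.
Context {R : realType}.
Local Notation mu := (@lebesgue_measure R).
Variable phi : R -> R.
Hypothesis phi_int : mu.-integrable setT (EFin \o phi).

Lemma complex_quotient (x y p k v : R) : 0 < x ->
  p%:C / ('i%C * k%:C * v%:C + (x +i* y)) =
  (p * ratio 0 x (k ^+ 2) (2 * k * y) (x ^+ 2 + y ^+ 2) v) +i*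
  (p * ratio (- k) (- y) (k ^+ 2) (2 * k * y) (x ^+ 2 + y ^+ 2) v).
Proof.
move=> x0.
have -> : 'i%C * k%:C * v%:C + (x +i* y) = x +i* (k * v + y).
  by apply/eqP; rewrite eq_complex /=; apply/andP; split; apply/eqP; ring.
have -> : (x +i* (k * v + y))^-1 =
  (ratio 0 x (k ^+ 2) (2 * k * y) (x ^+ 2 + y ^+ 2) v) +i*
  (ratio (- k) (- y) (k ^+ 2) (2 * k * y) (x ^+ 2 + y ^+ 2) v).
  apply/eqP; rewrite eq_complex /ratio/=.
  have -> : quad (k ^+ 2) (2 * k * y) (x ^+ 2 + y ^+ 2) v =
      x ^+ 2 + (k * v + y) ^+ 2 by rewrite /quad; ring.
  by rewrite mul0r add0r eqxx/= -mulNr opprD mulNr.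
by apply/eqP; rewrite eq_complex /= !mul0r subr0 addr0 !eqxx.
Qed.

Lemma dispersion_posquad (x y k : R) : k != 0 -> 0 < x ->
  posquad (k ^+ 2) (2 * k * y) (x ^+ 2 + y ^+ 2).
Proof.
move=> k0 x0; split; first by rewrite exprn_even_gt0.
rewrite -subr_gt0 (_ : _ - _ = 4 * (k ^+ 2 * x ^+ 2)); last by ring.
by apply: mulr_gt0 => //; apply: mulr_gt0; [rewrite exprn_even_gt0 | exact: exprn_gt0].
Qed.

(** With p the quadratic x^2 + (k v + y)^2, the imaginary part of [Delta] is - x / k times the
    integral of phi / p. Once that integral vanishes, the real part is 1 minus the integral of v phi
    / p. *)
Lemma Delta_eq0 (x y k : R) : k != 0 -> 0 < x ->
  Delta phi k (x +i* y) = 0 <->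
  qint phi 0 1 (k ^+ 2) (2 * k * y) (x ^+ 2 + y ^+ 2) = 0 /\
  qint phi 1 0 (k ^+ 2) (2 * k * y) (x ^+ 2 + y ^+ 2) = 1.
Proof.
move=> k0 x0; have pq := dispersion_posquad y k0 x0.
have -> : Delta phi k (x +i* y) =
  (1 + k^-1 * qint phi (- k) (- y) (k ^+ 2) (2 * k * y) (x ^+ 2 + y ^+ 2)) +i*
  (- (k^-1 * qint phi 0 x (k ^+ 2) (2 * k * y) (x ^+ 2 + y ^+ 2))).
  rewrite /Delta; under eq_fun do rewrite complex_quotient//.
  rewrite /cintegral/= -/(wint phi _) -/(wint phi _) -/(qint phi _ _ _ _ _).
  rewrite -/(qint phi _ _ _ _ _).
  have -> : ('i%C * k%:C)^-1 = 0 +i* (- k^-1).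
    apply/eqP; rewrite eq_complex/=; apply/andP; split; apply/eqP; field => //.
  by apply/eqP; rewrite eq_complex/=; apply/andP; split; apply/eqP; ring.
rewrite (qintE phi_int (- k))// (qintE phi_int 0 x)//.
set U := qint phi 0 1 _ _ _; set W := qint phi 1 0 _ _ _.
split.
  move/eqP; rewrite eq_complex/= => /andP[/eqP h1 /eqP h2].
  have U0 : U = 0.
    move: h2 => /eqP; rewrite mul0r add0r oppr_eq0 mulf_eq0 invr_eq0 (negbTE k0)/=.
    by rewrite mulf_eq0 gt_eqF//= => /eqP.
  split => //; move: h1; rewrite U0 mulr0 addr0 mulNr mulrN mulKf// => /eqP.
  by rewrite subr_eq0 => /eqP.
move=> [-> ->]; apply/eqP; rewrite eq_complex/=.
by apply/andP; split; apply/eqP; field.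
Qed.

End dispersion_relation.

(** * Uniqueness of the quadratic *)

Section uniqueness.
Context {R : realType}.
Local Notation mu := (@lebesgue_measure R).
Variables (phi : R -> R) (a b c : R).
Hypothesis phi_int : mu.-integrable setT (EFin \o phi).
Hypothesis phi_cubic : forall v, phi v * ((v - a) * (v - c) * (v - b)) <= 0.

Lemma quadratic_unique (A B1 C1 B2 C2 : R) :
    posquad A B1 C1 -> posquad A B2 C2 ->
    qint phi 0 1 A B1 C1 = 0 -> qint phi 1 0 A B1 C1 = 1 ->
    qint phi 0 1 A B2 C2 = 0 -> qint phi 1 0 A B2 C2 = 1 ->
  B1 = B2 /\ C1 = C2.
Proof.
move=> h1 h2 u1 w1 u2 w2.
(* Write p and q for the first and second quadratics. [E] is bilinear in the two affine numerators,
   so it is determined by the moments [E0], [E1], [E2] of phi / (p q). *)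
pose E al be al' be' :=
  wint phi (fun v => ratio al be A B1 C1 v * ratio al' be' A B2 C2 v).
have tE al be al' be' :
    tame (fun v => ratio al be A B1 C1 v * ratio al' be' A B2 C2 v).
  by apply: tameM; exact: tame_ratio.
pose E0 := E 0 1 0 1; pose E1 := E 1 0 0 1; pose E2 := E 1 0 1 0.
have EE al be al' be' :
    E al be al' be' = al * al' * E2 + (al * be' + be * al') * E1 + be * be' * E0.
  rewrite /E2 /E1 /E0 /E -!wintZ// -!wintD//;
    try by do ?apply: tameD; exact/tameZ/tE.
  by apply: eq_wint => v; rewrite /ratio; ring.
have q1 v : quad A B1 C1 v != 0 by rewrite gt_eqF// quad_gt0.
have q2 v : quad A B2 C2 v != 0 by rewrite gt_eqF// quad_gt0.
(* This is 1 / p - 1 / q = (q - p) / (p q), where q - p is affine since p and q share the leading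
   coefficient [A]. *)
have d1 al be : qint phi al be A B1 C1 - qint phi al be A B2 C2 =
    E al be (B2 - B1) (C2 - C1).
  rewrite /qint -wintB//; try exact: tame_ratio.
  apply: eq_wint => v; rewrite /ratio; move: (q1 v) (q2 v); rewrite /quad => ? ?.
  by field; apply/andP.
have A0 : A != 0 by case: h1 => /gt_eqF ->.
(* Multiply and divide by q. The term with A v^2 stays a separate integral because its numerator may
   be cubic, beyond the reach of [E]. *)
have d2 al be : qint phi al be A B1 C1 =
    A * wint phi (fun v => ratio al be A B1 C1 v * v * ratio 1 0 A B2 C2 v)
    + E al be B2 C2.
  have t1 : tame (fun v => ratio al be A B1 C1 v * v * ratio 1 0 A B2 C2 v).
    have -> : (fun v => ratio al be A B1 C1 v * v * ratio 1 0 A B2 C2 v) =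
      (fun v => A^-1 * (ratio al be A B1 C1 v -
         ratio al be A B1 C1 v * ratio B2 C2 A B2 C2 v)).
      apply/funext => v; rewrite /ratio.
      by move: (q1 v) (q2 v); rewrite /quad => ? ?; field; apply/and3P.
    by apply: tameZ; apply: tameB; [exact: tame_ratio|exact: tE].
  rewrite -wintZ// -wintD//; last exact: tameZ.
  apply: eq_wint => v; rewrite /ratio; move: (q1 v) (q2 v); rewrite /quad => ? ?.
  by field; apply/andP.
have e1 := d1 0 1; have e2 := d1 1 0.
rewrite u1 u2 EE subrr in e1; rewrite w1 w2 EE subrr in e2.
have e3 : A * E2 + B2 * E1 + C2 * E0 = 0.
  rewrite -[RHS]u1 d2 EE [X in _ = A * X + _](_ : _ = E2); first by ring.
  by apply: eq_wint => v; rewrite /ratio; ring.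
(* Since A (v - a) (v - b) is q minus an affine function, (v - a) (v - c) (v - b) / (p q) is a
   combination of (v - c) / p and weights of [E]. If the moments vanish, its integral against phi is
   1 / A > 0, against [phi_cubic]. *)
have contra_moments : E0 = 0 -> E1 = 0 -> E2 = 0 -> False.
  move=> E00 E10 E20.
  have : wint phi (fun v => A^-1 * (ratio 1 (- c) A B1 C1 v -
      ratio 1 (- c) A B1 C1 v *
      ratio (B2 + A * (a + b)) (C2 - A * (a * b)) A B2 C2 v)) <= 0.
    rewrite -oppr_ge0 -mulN1r -wintZ//; last first.
      by apply: tameZ; apply: tameB; [exact: tame_ratio|exact: tE].
    apply: Rintegral_ge0 => v _; rewrite mulN1r mulrN oppr_ge0.
    have -> : A^-1 * (ratio 1 (- c) A B1 C1 v - ratio 1 (- c) A B1 C1 v *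
      ratio (B2 + A * (a + b)) (C2 - A * (a * b)) A B2 C2 v) =
      (v - a) * (v - c) * (v - b) / (quad A B1 C1 v * quad A B2 C2 v).
      rewrite /ratio; move: (q1 v) (q2 v); rewrite /quad => ? ?.
      by field; apply/and3P.
    by rewrite mulrA pmulr_lle0 ?phi_cubic// invr_gt0 mulr_gt0 ?quad_gt0.
  rewrite wintZ//; last by apply: tameB; [exact: tame_ratio|exact: tE].
  rewrite wintB//; last exact: tame_ratio.
  rewrite -/(E _ _ _ _) EE -/(qint phi 1 (- c) A B1 C1) qintE// w1 u1 E00 E10 E20.
  rewrite !mulr0 !addr0 subr0 mulr1 mulr1 invr_le0 leNgt.
  by case: h1 => ->.
have e1' : (B2 - B1) * E1 + (C2 - C1) * E0 = 0 by rewrite e1; ring.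
have e2' : (B2 - B1) * E2 + (C2 - C1) * E1 = 0 by rewrite e2; ring.
have solve0 x y : x != 0 -> x * y = 0 -> y = 0 :> R.
  by move=> x0 /eqP; rewrite mulf_eq0 (negbTE x0) => /eqP.
have [dB|dB] := eqVneq (B2 - B1) 0.
  have [dC|dC] := eqVneq (C2 - C1) 0.
    by split; apply/eqP; rewrite eq_sym -subr_eq0; apply/eqP.
  exfalso; move: e1' e2'; rewrite dB !mul0r !add0r => /(solve0 _ _ dC) E00.
  move=> /(solve0 _ _ dC) E10.
  move: e3; rewrite E00 E10 !mulr0 !addr0 => /(solve0 _ _ A0) E20.
  by apply: (contra_moments E00 E10 E20).
(* [t] is the root of q - p. By [e1'] and [e2'] the moments up to order 2 are those of a mass [E0]
   at [t], so [e3] says q(t) E0 = 0 while q(t) > 0. *)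
exfalso; pose t := - (C2 - C1) / (B2 - B1).
have E1t : E1 = t * E0.
  apply: (mulfI dB); rewrite /t -[LHS]addr0 -[X in _ + X](subrr ((C2 - C1) * E0)).
  by rewrite addrA e1'; field.
have E2t : E2 = t ^+ 2 * E0.
  apply: (mulfI dB); rewrite /t -[LHS]addr0 -[X in _ + X](subrr ((C2 - C1) * E1)).
  by rewrite addrA e2' E1t /t; field.
have E00 : E0 = 0.
  apply: (@solve0 (quad A B2 C2 t)); first by rewrite gt_eqF// quad_gt0.
  by rewrite -[RHS]e3 E2t E1t /quad; ring.
move: E1t E2t; rewrite E00 !mulr0 => E10 E20.
by apply: (contra_moments E00 E10 E20).
Qed.

End uniqueness.

(** * The pencil of quadratics spanned by two squares *)

Section pencil.
Context {R : realType}.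
Local Notation mu := (@lebesgue_measure R).
Variables (a b : R).
Hypothesis ab : a < b.
Implicit Types m th v : R.

(* For a < m < b the squares of v - m and of the affine function slope m * v +
   icpt m, which takes the values m - a at a and b - m at b, agree at a and b.
   So the polynomials (1 - th) (v - m)^2 + th (slope m * v + icpt m)^2 differ by
   multiples of (v - a) (v - b); when 0 < th < 1 their nonreal root runs through
   the half-circle of Apollonius with ratio (m - a) / (b - m). *)
Definition slope m : R := (a + b - 2 * m) / (b - a).
Definition icpt m : R := (m * (a + b) - 2 * a * b) / (b - a).
(** The multiple of (v - a) (v - b) by which the two squares differ; equivalently 1 minus the square
    of [slope m]. *)
Definition gap m : R := 4 * (m - a) * (b - m) / (b - a) ^+ 2.
Definition penA m th : R := (1 - th) + th * slope m ^+ 2.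
Definition penB m th : R := 2 * (th * slope m * icpt m - (1 - th) * m).
Definition penC m th : R := (1 - th) * m ^+ 2 + th * icpt m ^+ 2.
Definition pen m th : R -> R := quad (penA m th) (penB m th) (penC m th).

Let ba0 : b - a != 0. Proof. by rewrite subr_eq0 gt_eqF. Qed.

Lemma penE m th v :
  pen m th v = (1 - th) * (v - m) ^+ 2 + th * (slope m * v + icpt m) ^+ 2.
Proof. by rewrite /pen /quad /penA /penB /penC; ring. Qed.

Lemma penE_gap m th v :
  pen m th v = (v - m) ^+ 2 - th * gap m * ((v - a) * (v - b)).
Proof. by rewrite penE /slope /icpt /gap; field. Qed.

Lemma penA_gap m th : penA m th = 1 - th * gap m.
Proof. by rewrite /penA /slope /gap; field. Qed.

Lemma chordE m v : slope m * v + icpt m =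
  (m - a) * ((b - v) / (b - a)) + (b - m) * ((v - a) / (b - a)).
Proof. by rewrite /slope /icpt; field. Qed.

Lemma gap_gt0 m : a < m < b -> 0 < gap m.
Proof.
case/andP=> am mb; apply: divr_gt0; last by rewrite exprn_gt0// subr_gt0.
by rewrite !mulr_gt0// subr_gt0.
Qed.

Lemma gap_le1 m : gap m <= 1.
Proof.
rewrite ler_pdivrMr ?exprn_gt0 ?subr_gt0// mul1r -subr_ge0.
by rewrite (_ : _ - _ = (a + b - 2 * m) ^+ 2) ?sqr_ge0//; ring.
Qed.

(** Minus the discriminant is 4 th (1 - th) times the square of the value at [m] of the second
    affine function. That value is positive, being a convex combination of m - a and b - m. *)
Lemma posquad_pen m th : a < m < b -> 0 < th < 1 ->
  posquad (penA m th) (penB m th) (penC m th).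
Proof.
move=> hm /andP[th0 th1]; have T0 := gap_gt0 hm; have T1 := gap_le1 m.
split; first by rewrite penA_gap subr_gt0; nra.
rewrite -subr_gt0.
rewrite (_ : _ - _ = 4 * (th * (1 - th)) * (slope m * m + icpt m) ^+ 2);
  last by rewrite /penA /penB /penC; ring.
apply: mulr_gt0; first by rewrite !mulr_gt0 ?subr_gt0.
rewrite exprn_gt0// chordE.
case/andP: hm => am mb.
by rewrite addr_gt0// mulr_gt0 ?divr_gt0 ?subr_gt0.
Qed.

Lemma pen_gt0 m th v : a < m < b -> 0 < th < 1 -> 0 < pen m th v.
Proof. by move=> hm hth; apply: quad_gt0; exact: posquad_pen. Qed.

Lemma chord_ge rho m v : rho <= m - a -> rho <= b - m -> a <= v <= b ->
  rho <= slope m * v + icpt m.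
Proof.
move=> h1 h2 /andP[av vb]; rewrite chordE.
have p : 0 <= (b - v) / (b - a) by rewrite divr_ge0 ?subr_ge0 ?(ltW ab).
have q : 0 <= (v - a) / (b - a) by rewrite divr_ge0 ?subr_ge0 ?(ltW ab).
have e : (b - v) / (b - a) + (v - a) / (b - a) = 1 by field.
nra.
Qed.

Lemma chord_le m v : a <= m <= b -> a <= v <= b -> slope m * v + icpt m <= b - a.
Proof.
move=> /andP[am mb] /andP[av vb]; rewrite chordE.
have p : 0 <= (b - v) / (b - a) by rewrite divr_ge0 ?subr_ge0 ?(ltW ab).
have q : 0 <= (v - a) / (b - a) by rewrite divr_ge0 ?subr_ge0 ?(ltW ab).
have e : (b - v) / (b - a) + (v - a) / (b - a) = 1 by field.
nra.
Qed.

Variable phi : R -> R.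
Hypothesis phi_int : mu.-integrable setT (EFin \o phi).

Definition pint al be m th := qint phi al be (penA m th) (penB m th) (penC m th).

Lemma pint_cvg {T : Type} {F : set_system T} {FF : Filter F} (m_ th_ : T -> R)
    al be m th : a < m < b -> 0 < th < 1 ->
  m_ @ F --> m -> th_ @ F --> th ->
  (fun x => penA (m_ x) (th_ x)) @ F --> penA m th /\
  (fun x => pint al be (m_ x) (th_ x)) @ F --> pint al be m th.
Proof.
move=> hm hth mm thth.
have c1 (x : R) : (fun=> x) @ F --> x by exact: cvg_cst.
have s : (fun x => slope (m_ x)) @ F --> slope m.
  by apply: cvgM => //; apply: cvgB => //; apply: cvgM.
have i : (fun x => icpt (m_ x)) @ F --> icpt m.
  by apply: cvgM => //; apply: cvgB => //; apply: cvgM.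
have t1 : (fun x => 1 - th_ x) @ F --> 1 - th by exact: cvgB.
have A : (fun x => penA (m_ x) (th_ x)) @ F --> penA m th.
  apply: cvgD => //; apply: cvgM => //.
  by apply: (@cvgM _ _ _ _ (slope \o m_) (slope \o m_)).
split => //; apply: qint_cvg => //; first exact: posquad_pen.
- by apply: cvgM => //; apply: cvgB; apply: cvgM => //; apply: cvgM.
- apply: cvgD; apply: cvgM => //; first exact: (@cvgM _ _ _ _ m_ m_).
  by apply: (@cvgM _ _ _ _ (icpt \o m_) (icpt \o m_)).
Qed.

Variables c K : R.
Hypothesis phi_cubic : forall v, phi v * ((v - a) * (v - c) * (v - b)) <= 0.
Hypothesis K0 : 0 < K.

(* It vanishes when the monic multiple q of pen m th satisfies
   int phi (v - c) / q = K, since q = pen m th / penA m th. *)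
Definition excess m th := pint 1 (- c) m th - K / penA m th.

Lemma excess_cvg {T : Type} {F : set_system T} {FF : Filter F} (m_ th_ : T -> R)
    m th : a < m < b -> 0 < th < 1 ->
  m_ @ F --> m -> th_ @ F --> th ->
  (fun x => excess (m_ x) (th_ x)) @ F --> excess m th.
Proof.
move=> hm hth mm thth.
have [hA hp] := pint_cvg 1 (- c) hm hth mm thth.
apply: cvgB => //; apply: cvgM; first exact: cvg_cst.
by apply: cvgV => //; case: (posquad_pen hm hth) => /gt_eqF ->.
Qed.

(** Two members of the pencil differ by a multiple of (v - a) (v - b), so by [phi_cubic] the
    integrands are ordered pointwise. Strictness comes from [K / penA], as [penA] decreases strictly
    in [th]. *)
Lemma excess_decr m th th' : a < m < b -> 0 < th < 1 -> 0 < th' < 1 ->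
  th < th' -> excess m th' < excess m th.
Proof.
move=> hm hth hth' lt; have T0 := gap_gt0 hm; have T1 := gap_le1 m.
have [A0 _] := posquad_pen hm hth; have [A0' _] := posquad_pen hm hth'.
rewrite /excess; apply: ler_ltB.
  apply: le_wint => //; try exact/tame_ratio/posquad_pen.
  move=> v; rewrite -subr_ge0 -mulrBr /ratio -/(pen m th v) -/(pen m th' v).
  have p := pen_gt0 v hm hth; have p' := pen_gt0 v hm hth'.
  have -> : (1 * v + - c) / pen m th v - (1 * v + - c) / pen m th' v =
     (pen m th' v - pen m th v) * (v - c) / (pen m th v * pen m th' v).
    by field; rewrite !gt_eqF.
  rewrite mulrA; apply: divr_ge0; last by apply: mulr_ge0; exact: ltW.
  rewrite !penE_gap.
  rewrite (_ : phi v * _ = - (phi v * ((v - a) * (v - c) * (v - b))) * ((th' - th) * gap m));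
    last by ring.
  by rewrite mulr_ge0 ?oppr_ge0 ?phi_cubic// mulr_ge0 ?ltW// subr_gt0.
rewrite ltr_pM2l// ltf_pV2 ?posrE// !penA_gap ltrD2l ltrN2 ltr_pM2r//.
Qed.

End pencil.

(** * Estimates for a quadratic whose roots are close to the origin *)

Section apollonius.
Context {R : realType}.
Implicit Types A B u x d p : R.

(* A quadratic A u^2 + B u + x^2 without real root has its complex roots on the
   circle of squared radius x^2 / A, hence in the disc of radius 2 x. *)
Lemma quad_disc A B u x p : 0 < x -> 1 / 4 <= A -> B ^+ 2 <= 4 * A * x ^+ 2 ->
  p = A * u ^+ 2 + B * u + x ^+ 2 ->
  (2 * x <= u -> A * (u - 2 * x) ^+ 2 <= p) /\
  (0 <= u -> p <= A * (u + 2 * x) ^+ 2).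
Proof.
move=> x0 A4 D ->.
have A0 : 0 < A by lra.
have BA : `|B| <= 4 * A * x.
  rewrite -(@ler_sqr _ `|B|) ?nnegrE ?mulr_ge0 ?(ltW A0) ?(ltW x0)//.
  rewrite real_normK ?num_real//; apply: (le_trans D).
  rewrite -subr_ge0 (_ : _ - _ = 4 * A * (4 * A - 1) * x ^+ 2); last by ring.
  by rewrite !mulr_ge0 ?sqr_ge0 ?(ltW A0)//; lra.
move: BA; rewrite ler_norml => /andP[B1 B2].
split=> hu.
  rewrite -(ler_pM2l A0).
  apply: (@le_trans _ _ ((A * u + B / 2) ^+ 2)).
    have -> : A * (A * (u - 2 * x) ^+ 2) = (A * (u - 2 * x)) ^+ 2 by ring.
    have l0 : 0 <= A * (u - 2 * x) by rewrite mulr_ge0 ?(ltW A0)// subr_ge0.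
    rewrite ler_sqr ?nnegrE//; last apply: (le_trans l0); nra.
  rewrite -subr_ge0 (_ : _ - _ = (4 * A * x ^+ 2 - B ^+ 2) / 4); last by field.
  by rewrite divr_ge0 ?subr_ge0.
rewrite -subr_ge0.
rewrite (_ : _ - _ = (4 * A * x - B) * u + (4 * A - 1) * x ^+ 2); last by ring.
by rewrite addr_ge0 ?mulr_ge0 ?sqr_ge0//; lra.
Qed.

(** By [quad_disc], A u / p is compared with u / (u - 2 x)^2 from above and with u / (u + 2 x)^2
    from below. Comparing these with their values at [d] reduces in both cases to the sign of (u -
    d) (u d - 4 x^2). *)
Lemma quad_disc_ratio A B u x d p :
  0 < x -> 1 / 4 <= A -> B ^+ 2 <= 4 * A * x ^+ 2 -> 0 < p ->
  p = A * u ^+ 2 + B * u + x ^+ 2 -> 2 * x < d ->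
  (d <= u -> A * u / p <= d / (d - 2 * x) ^+ 2) /\
  (2 * x <= u -> u <= d -> d / (d + 2 * x) ^+ 2 <= A * u / p).
Proof.
move=> x0 A4 D p0 pE xd; have [h1 h2] := quad_disc x0 A4 D pE.
have A0 : 0 < A by lra.
have d0 : 0 < d by lra.
split=> [du|xu ud].
  have s0 : 0 < (d - 2 * x) ^+ 2 by rewrite exprn_gt0// subr_gt0.
  have {}h1 : A * (u - 2 * x) ^+ 2 <= p by apply: h1; lra.
  rewrite ler_pdivrMr// mulrAC ler_pdivlMr//.
  apply: le_trans (ler_wpM2l (ltW d0) h1).
  rewrite -subr_ge0 (_ : _ - _ = A * ((u - d) * (u * d - (2 * x) ^+ 2))); last by ring.
  rewrite mulr_ge0 ?(ltW A0)// mulr_ge0 ?subr_ge0// expr2.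
  by apply: ler_pM; lra.
have s0 : 0 < (d + 2 * x) ^+ 2 by rewrite exprn_gt0//; lra.
have {}h2 : p <= A * (u + 2 * x) ^+ 2 by apply: h2; lra.
rewrite ler_pdivrMr// mulrAC ler_pdivlMr//.
apply: (le_trans (ler_wpM2l (ltW d0) h2)).
rewrite -subr_ge0 (_ : _ - _ = A * ((d - u) * (u * d - (2 * x) ^+ 2))); last by ring.
rewrite mulr_ge0 ?(ltW A0)// mulr_ge0 ?subr_ge0// expr2.
by apply: ler_pM; lra.
Qed.

End apollonius.

(** * Sign pattern of a two-peaked density *)

Section two_peaked_density.
Context {R : realType}.
Local Notation mu := (@lebesgue_measure R).
Variables (phi : R -> R) (a b c K : R).
Hypothesis phi_int : mu.-integrable setT (EFin \o phi).
Hypothesis phi_continuous : continuous phi.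
Hypothesis ac : a < c.
Hypothesis cb : c < b.
Hypothesis phi_ltc : forall v, a < v < c -> phi v < 0.
Hypothesis phi_gtc : forall v, c < v < b -> 0 < phi v.
Hypothesis phi_lta : forall v, v < a -> 0 < phi v.
Hypothesis phi_gtb : forall v, b < v -> phi v < 0.
Hypothesis phi_a : phi a = 0.
Hypothesis phi_b : phi b = 0.
Hypothesis phi_c : phi c = 0.
Hypothesis K0 : 0 < K.

Let ab : a < b. Proof. exact: lt_trans cb. Qed.

Lemma density_le_a v : v <= a -> 0 <= phi v.
Proof. by rewrite le_eqVlt => /predU1P[->|/phi_lta/ltW//]; rewrite phi_a. Qed.

Lemma density_ac v : a <= v <= c -> phi v <= 0.
Proof.
case/andP; rewrite le_eqVlt => /predU1P[<- _|av]; first by rewrite phi_a.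
rewrite le_eqVlt => /predU1P[->|vc]; first by rewrite phi_c.
by apply/ltW/phi_ltc; rewrite av.
Qed.

Lemma density_cb v : c <= v <= b -> 0 <= phi v.
Proof.
case/andP; rewrite le_eqVlt => /predU1P[<- _|av]; first by rewrite phi_c.
rewrite le_eqVlt => /predU1P[->|vc]; first by rewrite phi_b.
by apply/ltW/phi_gtc; rewrite av.
Qed.

Lemma density_ge_b v : b <= v -> phi v <= 0.
Proof. by rewrite le_eqVlt => /predU1P[<-|/phi_gtb/ltW//]; rewrite phi_b. Qed.

Lemma density_in v : a <= v <= b -> 0 <= phi v * (v - c).
Proof.
case/andP=> av vb; have [vc|cv] := leP v c.
  by rewrite mulr_le0 ?subr_le0// density_ac// av.
by rewrite mulr_ge0 ?subr_ge0 ?density_cb ?(ltW cv).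
Qed.

Lemma density_out v : v <= a \/ b <= v -> phi v * (v - c) <= 0.
Proof.
case=> h.
  by rewrite mulr_ge0_le0 ?density_le_a// subr_le0 (le_trans h)// ltW.
by rewrite mulr_le0_ge0 ?density_ge_b// subr_ge0 (le_trans _ h)// ltW.
Qed.

Lemma density_cubic v : phi v * ((v - a) * (v - c) * (v - b)) <= 0.
Proof.
rewrite (_ : _ * _ = phi v * (v - c) * ((v - a) * (v - b))); last by ring.
have [va|av] := leP v a.
  rewrite mulr_le0_ge0 ?density_out//; first by left.
  by rewrite mulr_le0 ?subr_le0// (le_trans va)// ltW.
have [vb|bv] := leP v b.
  rewrite mulr_ge0_le0 ?density_in ?(ltW av)//.
  by rewrite mulr_ge0_le0 ?subr_ge0 ?subr_le0// ltW.
rewrite mulr_le0_ge0 ?density_out//; first by right; exact: ltW.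
by rewrite mulr_ge0 ?subr_ge0// ltW.
Qed.

(** * The excess at the two ends of a half-circle *)

Let g v := phi v * (v - c).

Let g_continuous : continuous g.
Proof.
move=> v; apply: cvgM; first exact: phi_continuous.
by apply: cvgB; [exact: cvg_id | exact: cvg_cst].
Qed.

Let near_interval (P : R -> Prop) x : (\forall v \near x, P v) ->
  exists2 e : R, 0 < e & forall v, x < v <= x + e -> P v.
Proof.
move=> /nbhs_ballP[e /= e0 he]; exists (e / 2); first by rewrite divr_gt0.
move=> v /andP[xv vxe]; apply: he; rewrite /ball/= distrC gtr0_norm ?subr_gt0//.
lra.
Qed.

Let small_sqr (h : R) : 0 < h -> h <= 1 / 2 -> 0 < h ^+ 2 /\ h ^+ 2 <= 1 / 4.
Proof. by move=> h0 h1; split; [exact: exprn_gt0 | nra]. Qed.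

(** A spike of height eta / (h^2 D) and width h has area eta / (h D), which is large for small h. *)
Let spike_height (eta h D X : R) : 0 < eta -> 0 < h -> 0 < D ->
  h * (D * X) <= eta -> X <= eta / (h ^+ 2 * D) * h.
Proof.
move=> eta0 h0 D0 hX.
rewrite [leRHS](_ : _ = eta / (h * D)); last by field; rewrite !gt_eqF.
by rewrite ler_pdivlMr ?mulr_gt0// mulrC -mulrA.
Qed.

(** On [a, b] the integrand is nonnegative. Outside, v is at distance at least [rho] from [m], and
    the first square alone makes [pen] at least |v - m| rho / 2. *)
Lemma inner_bound m rho th v : a < m < b -> 0 < rho -> rho <= m - a -> rho <= b - m ->
  0 < th < 1 -> th <= 1 / 2 ->
  - (2 * (1 + (b - a) / rho) / rho * `|phi v|) <=
  phi v * ratio 1 (- c) (penA a b m th) (penB a b m th) (penC a b m th) v.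
Proof.
have [ac1 cb1] := conj ac cb; move=> hm rho0 rho1 rho2 hth th2.
have [th0 th1] := andP hth; have [am mb] := andP hm.
rewrite /ratio -/(pen a b m th v) mul1r.
have p0 := pen_gt0 ab v hm hth.
pose C := 2 * (1 + (b - a) / rho) / rho.
have C0 : 0 <= C.
  by rewrite divr_ge0 ?(ltW rho0)// mulr_ge0// addr_ge0// divr_ge0 ?subr_ge0 ?ltW.
have [vab|] := boolP (a <= v <= b).
  apply: (@le_trans _ _ 0); first by rewrite oppr_le0 mulr_ge0.
  by rewrite mulrA divr_ge0 ?density_in// ltW.
rewrite negb_and -!ltNge => vab.
have dm : rho <= `|v - m|.
  case/orP: vab => vab; rewrite ler_normr; apply/orP; [right|left].
    by rewrite opprB (le_trans rho1)// lerD2l lerN2 ltW.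
  by rewrite (le_trans rho2)// lerD2r ltW.
suff : `|(v - c) / pen a b m th v| <= C.
  move=> H; rewrite lerNl (le_trans (ler_norm _))//.
  by rewrite normrN normrM mulrC ler_wpM2r.
rewrite normrM normfV (gtr0_norm p0) ler_pdivrMr//.
have dc : `|v - c| <= `|v - m| * (1 + (b - a) / rho).
  have : `|v - c| <= `|v - m| + (b - a).
    rewrite (_ : v - c = (v - m) + (m - c)); last by ring.
    rewrite (le_trans (ler_normD _ _))// lerD2l ler_norml.
    by apply/andP; split; lra.
  move/le_trans; apply; rewrite mulrDr mulr1 lerD2l mulrA ler_pdivlMr//.
  by rewrite mulrC ler_wpM2r// subr_ge0 ltW.
apply: (le_trans dc).
have pv : 1 / 2 * (`|v - m| * rho) <= pen a b m th v.
  apply: (@le_trans _ _ ((1 - th) * `|v - m| ^+ 2)).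
    apply: ler_pM; rewrite ?mulr_ge0 ?(ltW rho0)//.
      by lra.
    by rewrite expr2; apply: ler_wpM2l.
  by rewrite penE real_normK ?num_real// lerDl mulr_ge0 ?sqr_ge0// ltW.
rewrite [leLHS](_ : _ = C * (1 / 2 * (`|v - m| * rho))).
  by apply: ler_wpM2l.
by rewrite /C; field; rewrite gt_eqF.
Qed.

(** As [th] tends to 0, [pen] degenerates to (v - m)^2. Since phi(v) (v - c) is positive at [m], the
    integral tends to infinity, while [K / penA] stays bounded. *)
Lemma inner_end_noncenter m : a < m < b -> m != c ->
  exists2 th, 0 < th < 1 & 0 < excess a b phi c K m th.
Proof.
have [K1 ac1 cb1] := And3 K0 ac cb; move=> hm mc; have [am mb] := andP hm.
have gm : 0 < g m.
  move: mc; rewrite neq_lt => /orP[h|h].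
    by rewrite nmulr_rgt0 ?subr_lt0// phi_ltc// am.
  by rewrite mulr_gt0 ?subr_gt0// phi_gtc// h.
have [e e0 he] : exists2 e : R, 0 < e & forall v, m < v <= m + e -> g m / 2 < g v.
  apply: near_interval.
  have := cvgr_gt _ (g_continuous (x := m)); apply.
  by rewrite ltr_pdivrMr// ltr_pMr// ltr1n.
pose eta := g m / 2; have eta0 : 0 < eta by rewrite divr_gt0.
pose rho := Num.min (m - a) (b - m).
have rho0 : 0 < rho by rewrite lt_min !subr_gt0 am.
have [rho1 rho2] : rho <= m - a /\ rho <= b - m.
  by rewrite /rho !ge_min !lexx orbT.
pose C := 2 * (1 + (b - a) / rho) / rho.
have C0 : 0 <= C.
  by rewrite divr_ge0 ?(ltW rho0)// mulr_ge0// addr_ge0// divr_ge0 ?subr_ge0 ?ltW.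
(* With [th] equal to h^2, [pen] is at most h^2 D on ]m, m + h]: the first square is at most h^2,
   and the second at most (b - a)^2 before its factor [th]. *)
pose D := 1 + (b - a) ^+ 2.
have D0 : 0 < D by rewrite ltr_pwDl// sqr_ge0.
(* The spike must exceed the loss [C * mass phi] plus 2 K, a bound for [K / penA] because [penA] is
   at least 1 / 2. *)
pose X := 2 * K + C * mass phi + 1.
have Cm : 0 <= C * mass phi by apply: mulr_ge0 => //; exact: mass_ge0.
have X0 : 0 < X by rewrite ltr_wpDl// addr_ge0// mulr_ge0// ltW.
pose h := Num.min (Num.min e (1 / 2)) (Num.min (b - m) (eta / (D * X))).
have h0 : 0 < h by rewrite !lt_min e0 subr_gt0 mb !divr_gt0// mulr_gt0.
have [he' hh hbm hX] : [/\ h <= e, h <= 1 / 2, h <= b - m & h <= eta / (D * X)].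
  by rewrite /h !ge_min !lexx !orbT.
rewrite ler_pdivlMr ?mulr_gt0// in hX.
have [th0 th4] := small_sqr h0 hh.
have th2 : h ^+ 2 <= 1 / 2 by lra.
have th1 : 0 < h ^+ 2 < 1 by rewrite th0; lra.
exists (h ^+ 2) => //.
have T1 := gap_le1 ab m; have T0 := gap_gt0 ab hm.
have [A0 _] := posquad_pen ab hm th1.
have A2 : 1 / 2 <= penA a b m (h ^+ 2).
  rewrite penA_gap//; have := ler_wpM2l (ltW th0) T1; lra.
have KA : K / penA a b m (h ^+ 2) <= 2 * K.
  rewrite ler_pdivrMr// mulrAC -[leLHS]mul1r; apply: ler_wpM2r; first exact: ltW.
  by lra.
rewrite /excess subr_gt0 (le_lt_trans KA)//.
pose kappa := eta / (h ^+ 2 * D).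
have -> : 2 * K = X - 1 - C * mass phi by rewrite /X; ring.
have kX : X <= kappa * h by exact: spike_height.
apply: (@lt_le_trans _ _ (kappa * h - C * mass phi)).
  by rewrite ltrD2r (lt_le_trans _ kX)// gtrBl.
apply: (spike_le_wint phi_int (x := m)) => //.
- exact/tame_ratio/posquad_pen.
- exact: ltW.
- move=> v /andP[mv vh]; rewrite /ratio -/(pen a b m (h ^+ 2) v) mul1r mulrA -/(g v).
  have p0 := pen_gt0 ab v hm th1.
  rewrite ler_pdivlMr// /kappa mulrAC ler_pdivrMr ?mulr_gt0//.
  have gv : eta <= g v by apply/ltW/he; rewrite mv (le_trans vh)// lerD2l.
  have pv : pen a b m (h ^+ 2) v <= h ^+ 2 * D.
    rewrite penE /D mulrDr mulr1 lerD//.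
      have : (v - m) ^+ 2 <= h ^+ 2.
        by rewrite ler_sqr ?nnegrE ?subr_ge0 ?(ltW mv) ?(ltW h0)// lerBlDl.
      by apply: le_trans; rewrite ler_piMl ?sqr_ge0// gerBl ltW.
    have vab : a <= v <= b.
      by rewrite (ltW (lt_trans am mv)) (le_trans vh)// -lerBrDl.
    apply: ler_wpM2l; first exact: ltW.
    rewrite ler_sqr ?nnegrE.
    - by apply: chord_le => //; rewrite !ltW.
    - by rewrite (le_trans (ltW rho0))//; apply: chord_ge.
    - by rewrite subr_ge0 ltW.
  by rewrite ler_pM ?(ltW eta0) ?(ltW p0).
- by move=> v; exact: inner_bound.
Qed.

(** Outside [a, b] the sign is favourable. Inside, the second affine function is at least [rho], so
    [pen] is at least rho^2 / 2. *)
Lemma outer_bound m rho th v : a < m < b -> 0 < rho -> rho <= m - a -> rho <= b - m ->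
  0 < th < 1 -> 1 / 2 <= th ->
  - (2 * (b - a) / rho ^+ 2 * `|phi v|) <=
  phi v * - ratio 1 (- c) (penA a b m th) (penB a b m th) (penC a b m th) v.
Proof.
have [ac1 cb1] := conj ac cb; move=> hm rho0 rho1 rho2 hth th2; have [th0 th1] := andP hth.
rewrite /ratio -/(pen a b m th v) mul1r.
have p0 := pen_gt0 ab v hm hth.
have C0 : 0 <= 2 * (b - a) / rho ^+ 2.
  by rewrite divr_ge0 ?sqr_ge0 ?mulr_ge0 ?subr_ge0 ?(ltW ab).
have [vab|] := boolP (a <= v <= b); last first.
  rewrite negb_and -!ltNge => vab.
  apply: (@le_trans _ _ 0); first by rewrite oppr_le0 mulr_ge0.
  rewrite mulrN oppr_ge0 mulrA; apply: mulr_le0_ge0; last by rewrite invr_ge0 ltW.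
  apply: density_out; case/orP: vab => /ltW; [by left | by right].
rewrite mulrN lerN2 (le_trans (ler_norm _))// normrM mulrC ler_wpM2r//.
rewrite normrM normfV (gtr0_norm p0) ler_pdivrMr//.
have dv : `|v - c| <= b - a by case/andP: vab => ? ?; rewrite ler_norml; apply/andP; split; lra.
have pv : rho ^+ 2 / 2 <= pen a b m th v.
  have l := chord_ge ab rho1 rho2 vab.
  have l2 : rho ^+ 2 <= (slope a b m * v + icpt a b m) ^+ 2.
    have r0 := ltW rho0.
    by rewrite ler_sqr ?nnegrE// (le_trans r0).
  rewrite penE; have := sqr_ge0 (v - m); have := sqr_ge0 rho; nra.
apply: (le_trans dv).
rewrite [leLHS](_ : _ = 2 * (b - a) / rho ^+ 2 * (rho ^+ 2 / 2)).
  by apply: ler_wpM2l.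
by field; rewrite gt_eqF.
Qed.

(** As [th] tends to 1, [pen] degenerates to the second square. Either its root lies outside [a, b],
    where phi(v) (v - c) is negative and drives the integral to minus infinity, or it is constant
    and [K / penA] blows up. *)
Lemma outer_end m : a < m < b ->
  exists2 th, 0 < th < 1 & excess a b phi c K m th < 0.
Proof.
have [K1 ac1 cb1] := And3 K0 ac cb; move=> hm; have [am mb] := andP hm.
pose rho := Num.min (m - a) (b - m).
have rho0 : 0 < rho by rewrite lt_min !subr_gt0 am.
have [rho1 rho2] : rho <= m - a /\ rho <= b - m.
  by rewrite /rho !ge_min !lexx orbT.
pose C := 2 * (b - a) / rho ^+ 2.
have C0 : 0 <= C by rewrite divr_ge0 ?sqr_ge0 ?mulr_ge0 ?subr_ge0 ?(ltW ab).
pose X := C * mass phi + 1.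
have Cm : 0 <= C * mass phi by apply: mulr_ge0 => //; exact: mass_ge0.
have X0 : 0 < X by rewrite ltr_wpDl.
have JN th : 0 < th < 1 ->
  pint a b phi 1 (- c) m th =
  - wint phi (fun v => - ratio 1 (- c) (penA a b m th) (penB a b m th) (penC a b m th) v).
  move=> hth; rewrite -[RHS]mulN1r -wintZ//; last exact/tameN/tame_ratio/posquad_pen.
  by apply: eq_wint => v; rewrite mulN1r opprK.
(* Zero slope means that [m] is the midpoint; then [penA] is 1 - th, and a bounded integral is
   enough. *)
have [s0|s0] := eqVneq (slope a b m) 0.
  pose d := Num.min (1 / 2) (K / X).
  have d0 : 0 < d by rewrite lt_min !divr_gt0.
  have [d2 dK] : d <= 1 / 2 /\ d <= K / X by rewrite /d !ge_min !lexx orbT.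
  have th1 : 0 < 1 - d < 1 by clearbody d; apply/andP; split; lra.
  have th2 : 1 / 2 <= 1 - d by clearbody d; lra.
  exists (1 - d) => //; rewrite /excess subr_lt0 JN//.
  rewrite [X in _ < K / X](_ : _ = d); last by rewrite /penA s0; ring.
  apply: (@lt_le_trans _ _ X).
    (* A spike of height and width 0: only the bound by [mass] is used. *)
    rewrite ltrNl; apply: (@lt_le_trans _ _ (0 * 0 - C * mass phi)).
      by rewrite mul0r sub0r ltrN2 /X ltrDl.
    apply: (spike_le_wint phi_int (x := 0)) => //.
    - exact/tameN/tame_ratio/posquad_pen.
    - by move=> v /andP[v0]; rewrite addr0 leNgt v0.
    - by move=> v; exact: outer_bound.
  by rewrite ler_pdivlMr// mulrC -ler_pdivlMr.
pose v0 := - icpt a b m / slope a b m.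
have lv v : slope a b m * v + icpt a b m = slope a b m * (v - v0).
  by rewrite /v0; field.
have v0out : v0 < a \/ b < v0.
  have [?|av0] := ltP v0 a; first by left.
  have [?|v0b] := ltP b v0; first by right.
  have := @chord_ge _ _ _ ab rho m v0 rho1 rho2.
  rewrite av0 v0b => /(_ isT); rewrite lv subrr mulr0 => h.
  by move: rho0; rewrite ltNge h.
have gv0 : g v0 < 0.
  case: v0out => h.
    by rewrite pmulr_rlt0 ?phi_lta// subr_lt0 (lt_trans h).
  by rewrite nmulr_rlt0 ?phi_gtb// subr_gt0 (lt_trans _ h).
have [e e0 he] : exists2 e : R, 0 < e & forall v, v0 < v <= v0 + e -> g v < g v0 / 2.
  apply: near_interval.
  have := cvgr_lt _ (g_continuous (x := v0)); apply.
  lra.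
pose eta := - (g v0 / 2); have eta0 : 0 < eta by rewrite /eta; lra.
(* Again h^2 D bounds [pen] on the spike. Now h^2 is the factor 1 - th of the first square, and the
   second is the squared slope times (v - v0)^2. *)
pose D := (`|v0 - m| + 1) ^+ 2 + slope a b m ^+ 2.
have D0 : 0 < D.
  by rewrite ltr_pwDl ?sqr_ge0// exprn_gt0// ltr_wpDl.
pose h := Num.min (Num.min e (1 / 2)) (eta / (D * X)).
have h0 : 0 < h by rewrite !lt_min e0 !divr_gt0// mulr_gt0.
have [he' hh hX] : [/\ h <= e, h <= 1 / 2 & h <= eta / (D * X)].
  by rewrite /h !ge_min !lexx !orbT.
rewrite ler_pdivlMr ?mulr_gt0// in hX.
have [h20 h24] := small_sqr h0 hh.
have th1 : 0 < 1 - h ^+ 2 < 1 by apply/andP; split; lra.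
have th2 : 1 / 2 <= 1 - h ^+ 2 by lra.
exists (1 - h ^+ 2) => //.
have [A0 _] := posquad_pen ab hm th1.
rewrite /excess subr_lt0 JN// (@lt_trans _ _ 0)//; last by rewrite divr_gt0.
rewrite oppr_lt0.
pose kappa := eta / (h ^+ 2 * D).
have kX : X <= kappa * h by exact: spike_height.
apply: (@lt_le_trans _ _ (kappa * h - C * mass phi)).
  by rewrite subr_gt0 (lt_le_trans _ kX)// /X ltrDl.
apply: (spike_le_wint phi_int (x := v0)) => //.
- exact/tameN/tame_ratio/posquad_pen.
- exact: ltW.
- move=> v /andP[v0v vh].
  rewrite /ratio -/(pen a b m (1 - h ^+ 2) v) mul1r mulrN mulrA -/(g v) -mulNr.
  have p0 := pen_gt0 ab v hm th1.
  rewrite ler_pdivlMr// /kappa mulrAC ler_pdivrMr ?mulr_gt0//.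
  have gv : eta <= - g v.
    by rewrite /eta lerN2; apply/ltW/he; rewrite v0v (le_trans vh)// lerD2l.
  have pv : pen a b m (1 - h ^+ 2) v <= h ^+ 2 * D.
    rewrite penE lv subKr /D [leRHS]mulrDr lerD//.
      apply: ler_wpM2l; first exact: ltW.
      rewrite -[(v - m) ^+ 2]real_normK ?num_real//.
      rewrite ler_sqr ?nnegrE ?addr_ge0// (_ : v - m = (v0 - m) + (v - v0)); last by ring.
      rewrite (le_trans (ler_normD _ _))// lerD2l gtr0_norm ?subr_gt0// lerBlDl.
      by rewrite (le_trans vh)// lerD2l (le_trans hh)// ler_pdivrMr// mul1r ler1n.
    rewrite exprMn mulrCA [leRHS]mulrC ler_wpM2l ?sqr_ge0//.
    have : (v - v0) ^+ 2 <= h ^+ 2.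
      by rewrite ler_sqr ?nnegrE ?subr_ge0 ?(ltW v0v) ?(ltW h0)// lerBlDl.
    by apply: le_trans; rewrite ler_piMl ?sqr_ge0// gerBl ltW.
  by rewrite ler_pM ?(ltW eta0) ?(ltW p0).
- by move=> v; exact: outer_bound.
Qed.

(** * Half-circles close to [a] or [b] *)

Variable f : R -> R.
Hypothesis wint_phi_heaviside : forall x, wint phi (heaviside x) = f x.
Hypothesis wint_phi_cst : wint phi (fun=> 1) = 0.
Hypothesis f_continuous : continuous f.
Hypothesis f_c : f c = 0.
Hypothesis f_ab : f a = f b.

(** Supplies the lower bound on the leading coefficient asked for by [quad_disc]: [gap] is 4 t (1 -
    t) with t = (m - a) / (b - a), at most 3 / 4 when t is within 1 / 4 of 0 or 1. *)
Lemma penA_ge m th : a < m < b -> 0 < th < 1 ->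
  m - a <= (b - a) / 4 \/ b - m <= (b - a) / 4 -> 1 / 4 <= penA a b m th.
Proof.
move=> hm /andP[th0 th1] h; have ab' := ab; have [am mb] := andP hm.
have T0 := gap_gt0 ab hm.
suff T : gap a b m <= 3 / 4.
  have := ler_wpM2r (ltW T0) (ltW th1); rewrite mul1r penA_gap//; lra.
rewrite ler_pdivrMr ?exprn_gt0 ?subr_gt0//.
by case: h; nra.
Qed.

Let cvg_shift x : (fun d => f (x + d)) @ (0 : R) --> f x.
Proof.
have h : (fun d => x + d) @ (0 : R) --> x.
  by rewrite -[X in _ --> X]addr0; apply: cvgD; [exact: cvg_cst | exact: cvg_id].
exact: (cvg_comp _ _ h (f_continuous (x := x))).
Qed.

Let cvg_shiftN x : (fun d => f (x - d)) @ (0 : R) --> f x.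
Proof.
have h : (fun d => x - d) @ (0 : R) --> x.
  by rewrite -[X in _ --> X]subr0; apply: cvgB; [exact: cvg_cst | exact: cvg_id].
exact: (cvg_comp _ _ h (f_continuous (x := x))).
Qed.

Let cvg_slope (d : R) : 0 < d ->
  (fun x => d / (d + x) ^+ 2) @ (0 : R) --> d^-1 /\
  (fun x => d / (d - x) ^+ 2) @ (0 : R) --> d^-1.
Proof.
move=> d0; have dE : d^-1 = d / d ^+ 2 by field; rewrite gt_eqF.
split; rewrite dE; (apply: cvgM; first exact: cvg_cst).
  apply: cvgV; first by rewrite gt_eqF// exprn_gt0.
  have h : (fun x => d + x) @ (0 : R) --> d.
    by rewrite -[X in _ --> X]addr0; apply: cvgD; [exact: cvg_cst | exact: cvg_id].
  exact: (@cvgM _ _ _ _ (fun x => d + x) (fun x => d + x)).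
apply: cvgV; first by rewrite gt_eqF// exprn_gt0.
have h : (fun x => d - x) @ (0 : R) --> d.
  by rewrite -[X in _ --> X]subr0; apply: cvgB; [exact: cvg_cst | exact: cvg_id].
exact: (@cvgM _ _ _ _ (fun x => d - x) (fun x => d - x)).
Qed.

Let near0 (P : R -> Prop) : (\forall d \near (0 : R), P d) ->
  exists2 e : R, 0 < e & forall d, 0 < d < e -> P d.
Proof.
move=> /nbhs_ballP[e /= e0 he]; exists e => //.
by move=> d /andP[d0 de]; apply: he; rewrite /ball/= sub0r normrN gtr0_norm.
Qed.

(** When [m] is near [a], the weight penA (v - a) / pen is close to 1 / (v - a) away from [a].
    Comparing it on both sides of [c] with its approximate value 1 / (c - a) gives a step function
    that vanishes up to slightly above [a] and after [b]. Its integral tends to (f b - f a) / (c -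
    a) = 0. *)
Lemma near_left : exists2 e, 0 < e & forall m th, a < m < b -> m < a + e ->
  0 < th < 1 -> penA a b m th * pint a b phi 1 (- a) m th < K.
Proof.
have [ab1 ac1 cb1] := And3 ab ac cb.
pose d := c - a; have d0 : 0 < d by rewrite subr_gt0.
pose s (x : R) := [:: (a + x, d / (d + x) ^+ 2); (c, d / (d - x) ^+ 2); (b, 0)].
have [e0 e00 he] : exists2 e : R, 0 < e &
    forall x, 0 < x < e -> step_sum f 0 (s x) < K.
  apply: near0.
  have [c1 c2] := cvg_slope d0.
  have lim : (fun x => step_sum f 0 (s x)) @ (0 : R) -->
      (0 - d^-1) * f a + ((d^-1 - d^-1) * f c + ((d^-1 - 0) * f b + 0)).
    apply: cvgD.
      by apply: cvgM; [apply: cvgB => //; exact: cvg_cst|exact: cvg_shift].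
    apply: cvgD; first by apply: cvgM; [exact: cvgB|exact: cvg_cst].
    apply: cvgD; last exact: cvg_cst.
    by apply: cvgM; [apply: cvgB => //|]; exact: cvg_cst.
  have := cvgr_lt _ lim; apply.
  by rewrite f_ab [X in X < _](_ : _ = 0)//; ring.
pose e := Num.min (e0 / 2) (Num.min ((b - a) / 4) (d / 2)).
have e_gt0 : 0 < e by rewrite !lt_min !divr_gt0 ?subr_gt0.
have [e1 e2 e3] : [/\ e <= e0 / 2, e <= (b - a) / 4 & e <= d / 2].
  by rewrite /e !ge_min !lexx !orbT.
exists e => // m th hm me hth; have [am mb] := andP hm.
pose x := m - a; have x0 : 0 < x by rewrite subr_gt0.
have xe : x < e by rewrite ltrBlDl.
have pq := posquad_pen ab hm hth.
have A4 : 1 / 4 <= penA a b m th.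
  by apply: penA_ge => //; left; exact: le_trans (ltW xe) e2.
have xd : 2 * x < d by clearbody e d; lra.
(* The steps are taken with shift 2 x, the radius of the disc in [quad_disc]. *)
have hx : 0 < 2 * x < e0 by clearbody e x; apply/andP; split; lra.
rewrite -wintZ//; last exact: tame_ratio.
apply: (le_lt_trans _ (he _ hx)).
apply: (wint_le_step phi_int wint_phi_heaviside wint_phi_cst).
- by rewrite /= -lerBrDl (ltW cb1) andbT ltW.
- exact/tameZ/tame_ratio.
move=> v.
have p0 := pen_gt0 ab v hm hth.
pose u := v - a.
(* Expansion around [a]; the constant term is [pen] at [a], that is (m - a)^2. *)
have pE : pen a b m th v =
    penA a b m th * u ^+ 2 + (penB a b m th + 2 * a * penA a b m th) * u + x ^+ 2.
  have := penE_gap ab m th a; rewrite subrr mul0r mulr0 subr0 => pa.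
  have -> : x ^+ 2 = pen a b m th a by rewrite pa /x; ring.
  by rewrite /u /pen /quad; ring.
have D4 : (penB a b m th + 2 * a * penA a b m th) ^+ 2 <= 4 * penA a b m th * x ^+ 2.
  have := penE_gap ab m th a; rewrite subrr mul0r mulr0 subr0 => pa.
  have -> : x ^+ 2 = pen a b m th a by rewrite pa /x; ring.
  have [_ /ltW] := pq; rewrite -subr_ge0 => h.
  rewrite -subr_ge0 (_ : _ - _ = 4 * penA a b m th * penC a b m th - penB a b m th ^+ 2)//.
  by rewrite /pen /quad; ring.
have [h1 h2] := quad_disc_ratio x0 A4 D4 p0 pE xd.
have -> : penA a b m th * ratio 1 (- a) (penA a b m th) (penB a b m th) (penC a b m th) v =
    penA a b m th * u / pen a b m th v by rewrite /ratio /u /pen mul1r mulrA.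
have A0 : 0 < penA a b m th by case: pq.
have [va|av] := leP v a.
  rewrite /= (le_trans va) ?lerDl ?mulr_ge0 ?(ltW x0)// mulr0 mulr_ge0_le0 ?density_le_a//.
  by rewrite mulr_le0_ge0 ?invr_ge0 ?(ltW p0)// mulr_ge0_le0 ?(ltW A0)// subr_le0.
have u0 : 0 <= u by rewrite subr_ge0 ltW.
have w0 : 0 <= penA a b m th * u / pen a b m th v.
  by rewrite divr_ge0 ?(ltW p0)// mulr_ge0// (ltW A0).
have [vx|xv] := leP v (a + 2 * x).
  rewrite /= vx mulr0 mulr_le0_ge0// density_ac// (ltW av)/=.
  by apply: (le_trans vx); rewrite -lerBrDl ltW.
have [vc|cv] := leP v c.
  rewrite /= (lt_geF xv)/= vc ler_wnM2l ?density_ac ?(ltW av)//.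
  by apply: h2; rewrite /u ?lerD2r// lerBrDl ltW.
have [vb|bv] := leP v b.
  rewrite /= (lt_geF xv)/= (lt_geF cv)/= vb ler_wpM2l ?density_cb ?(ltW cv)//.
  by apply: h1; rewrite /u lerD2r ltW.
rewrite /= (lt_geF xv)/= (lt_geF cv)/= (lt_geF bv)/= mulr0 mulr_le0_ge0//.
by rewrite density_ge_b// ltW.
Qed.

(** Mirror image of [near_left] in the variable b - v; the reflection turns v - b into - u, hence
    the negative step values. *)
Lemma near_right : exists2 e, 0 < e & forall m th, a < m < b -> b - e < m ->
  0 < th < 1 -> penA a b m th * pint a b phi 1 (- b) m th < K.
Proof.
have [ab1 ac1 cb1] := And3 ab ac cb.
pose d := b - c; have d0 : 0 < d by rewrite subr_gt0.
pose s (x : R) := [:: (a, - (d / (d - x) ^+ 2)); (c, - (d / (d + x) ^+ 2)); (b - x, 0)].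
have [e0 e00 he] : exists2 e : R, 0 < e &
    forall x, 0 < x < e -> step_sum f 0 (s x) < K.
  apply: near0.
  have [c1 c2] := cvg_slope d0.
  have lim : (fun x => step_sum f 0 (s x)) @ (0 : R) -->
      (0 - - d^-1) * f a + ((- d^-1 - - d^-1) * f c + ((- d^-1 - 0) * f b + 0)).
    apply: cvgD.
      apply: cvgM; last exact: cvg_cst.
      by apply: cvgB; [exact: cvg_cst|exact: cvgN].
    apply: cvgD; first by apply: cvgM; [apply: cvgB; exact: cvgN|exact: cvg_cst].
    apply: cvgD; last exact: cvg_cst.
    apply: cvgM; last exact: cvg_shiftN.
    by apply: cvgB; [exact: cvgN|exact: cvg_cst].
  have := cvgr_lt _ lim; apply.
  by rewrite f_ab [X in X < _](_ : _ = 0)//; ring.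
pose e := Num.min (e0 / 2) (Num.min ((b - a) / 4) (d / 2)).
have e_gt0 : 0 < e by rewrite !lt_min !divr_gt0 ?subr_gt0.
have [e1 e2 e3] : [/\ e <= e0 / 2, e <= (b - a) / 4 & e <= d / 2].
  by rewrite /e !ge_min !lexx !orbT.
exists e => // m th hm me hth; have [am mb] := andP hm.
pose x := b - m; have x0 : 0 < x by rewrite subr_gt0.
have xe : x < e by rewrite ltrBlDr -ltrBlDl.
have pq := posquad_pen ab hm hth.
have A4 : 1 / 4 <= penA a b m th.
  by apply: penA_ge => //; right; exact: le_trans (ltW xe) e2.
have xd : 2 * x < d by clearbody e d; lra.
have hx : 0 < 2 * x < e0 by clearbody e x; apply/andP; split; lra.
have cx : c < b - 2 * x by rewrite ltrBrDl -ltrBrDr.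
rewrite -wintZ//; last exact: tame_ratio.
apply: (le_lt_trans _ (he _ hx)).
apply: (wint_le_step phi_int wint_phi_heaviside wint_phi_cst).
- by rewrite /= (ltW ac1) (ltW cx).
- exact/tameZ/tame_ratio.
move=> v.
have p0 := pen_gt0 ab v hm hth.
pose u := b - v.
have pE : pen a b m th v =
    penA a b m th * u ^+ 2 + (- (penB a b m th + 2 * b * penA a b m th)) * u + x ^+ 2.
  have := penE_gap ab m th b; rewrite subrr !mulr0 subr0 => pa.
  have -> : x ^+ 2 = pen a b m th b by rewrite pa /x; ring.
  by rewrite /u /pen /quad; ring.
have D4 : (- (penB a b m th + 2 * b * penA a b m th)) ^+ 2 <= 4 * penA a b m th * x ^+ 2.
  have := penE_gap ab m th b; rewrite subrr !mulr0 subr0 => pa.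
  have -> : x ^+ 2 = pen a b m th b by rewrite pa /x; ring.
  have [_ /ltW] := pq; rewrite -subr_ge0 => h.
  rewrite -subr_ge0 (_ : _ - _ = 4 * penA a b m th * penC a b m th - penB a b m th ^+ 2)//.
  by rewrite /pen /quad; ring.
have [h1 h2] := quad_disc_ratio x0 A4 D4 p0 pE xd.
have -> : penA a b m th * ratio 1 (- b) (penA a b m th) (penB a b m th) (penC a b m th) v =
    - (penA a b m th * u / pen a b m th v).
  by rewrite /ratio /u /pen mul1r -mulNr -mulrN opprB mulrA.
have A0 : 0 < penA a b m th by case: pq.
have [bv|vb] := leP b v.
  have xv : b - 2 * x < v by rewrite (lt_le_trans _ bv)// gtrBl mulr_gt0.
  rewrite /= (lt_geF (lt_le_trans ab1 bv)) (lt_geF (lt_le_trans cb1 bv)).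
  rewrite (lt_geF xv) mulr0 mulr_le0_ge0 ?density_ge_b// oppr_ge0.
  by rewrite mulr_le0_ge0 ?invr_ge0 ?(ltW p0)// mulr_ge0_le0 ?(ltW A0)// subr_le0.
have u0 : 0 <= u by rewrite subr_ge0 ltW.
have w0 : - (penA a b m th * u / pen a b m th v) <= 0.
  by rewrite oppr_le0 divr_ge0 ?(ltW p0)// mulr_ge0// (ltW A0).
have [va|av] := leP v a.
  by rewrite /= va mulr0 mulr_ge0_le0 ?density_le_a.
have [vc|cv] := leP v c.
  rewrite /= (lt_geF av)/= vc ler_wnM2l ?density_ac ?(ltW av)// lerN2.
  by apply: h1; rewrite /u /d lerD2l lerN2.
have d_ge : 0 <= phi v by rewrite density_cb ?(ltW cv) ?(ltW vb).
have [vx|xv] := leP v (b - 2 * x).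
  rewrite /= (lt_geF av)/= (lt_geF cv)/= vx ler_wpM2l// lerN2.
  by apply: h2; rewrite /u ?/d ?lerD2l ?lerN2 ?(ltW cv)// lerBrDl -lerBrDr.
by rewrite /= (lt_geF av)/= (lt_geF cv)/= (lt_geF xv)/= mulr0 mulr_ge0_le0.
Qed.

(** * The inner end of the half-circle with foot [c] *)

Let center_upper th v x : 0 < th < 1 -> 0 < x -> x <= `|v - c| ->
  `|v - c| / pen a b c th v <= ((1 - th) * x)^-1.
Proof.
move=> hth x0 xv; have [th0 th1] := andP hth.
have hc : a < c < b by rewrite ac cb.
have p0 := pen_gt0 ab v hc hth.
have y0 : 0 < `|v - c| by exact: lt_le_trans xv.
have t0 : 0 < 1 - th by rewrite subr_gt0.
rewrite ler_pdivrMr// ler_pdivlMl ?mulr_gt0//.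
apply: (@le_trans _ _ ((1 - th) * `|v - c| ^+ 2)).
  by rewrite expr2 mulrA; apply: ler_wpM2r => //; apply: ler_wpM2l => //; exact: ltW.
by rewrite real_normK ?num_real// penE lerDl mulr_ge0 ?sqr_ge0// ltW.
Qed.

(** The cube is chosen so that, at distance at least e from [c], the second term of [pen], at most
    e^3 (b - a)^2, is at most e (b - a)^2 times (v - c)^2. Thus [pen] is (v - c)^2 up to a factor
    tending to 1. *)
Let center_lower e v x : 0 < e < 1 -> a <= v <= b -> e <= `|v - c| ->
  `|v - c| <= x ->
  (x * (1 + e * (b - a) ^+ 2))^-1 <= `|v - c| / pen a b c (e ^+ 3) v.
Proof.
move=> /andP[e0 e1] vab ev vx.
have hc : a < c < b by rewrite ac cb.
have th0 : 0 < e ^+ 3 by rewrite exprn_gt0.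
have th1 : e ^+ 3 < 1 by rewrite exprn_ilt1// ltW.
have hth : 0 < e ^+ 3 < 1 by rewrite th0.
have p0 := pen_gt0 ab v hc hth.
have y0 : 0 < `|v - c| by exact: lt_le_trans ev.
have x0 : 0 < x by exact: lt_le_trans vx.
have k0 : 0 < 1 + e * (b - a) ^+ 2.
  by rewrite ltr_pwDl// mulr_ge0 ?sqr_ge0// ltW.
rewrite ler_pdivlMr// ler_pdivrMl ?mulr_gt0//.
apply: (@le_trans _ _ (`|v - c| ^+ 2 * (1 + e * (b - a) ^+ 2))).
  rewrite mulrDr mulr1 penE real_normK ?num_real//; apply: lerD.
    rewrite ler_piMl ?sqr_ge0//.
    by rewrite gerBl ltW.
  have ch : (slope a b c * v + icpt a b c) ^+ 2 <= (b - a) ^+ 2.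
    have l0 : 0 <= slope a b c * v + icpt a b c.
      by apply: (chord_ge ab) => //; rewrite subr_ge0 ltW.
    rewrite ler_sqr ?nnegrE//; last by rewrite subr_ge0 ltW.
    by apply: chord_le => //; rewrite !ltW.
  have -> : e ^+ 3 = e ^+ 2 * e by ring.
  rewrite -mulrA; apply: ler_pM.
  - exact: sqr_ge0.
  - by apply: mulr_ge0; [exact: ltW|exact: sqr_ge0].
  - by rewrite -[leRHS]real_normK ?num_real// ler_sqr ?nnegrE// ltW.
  - by apply: ler_wpM2l => //; exact: ltW.
rewrite expr2 -mulrA [leRHS]mulrC; apply: ler_wpM2l => //.
by apply: ler_wpM2r => //; exact: ltW.
Qed.

(** On each piece, 1 / (v - c) is replaced by its least favourable endpoint value for the sign of
    phi there. Between c - e and c + e the integrand is nonnegative and is bounded below by 0. *)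
Let center_step_le e sigma tau v : 0 < sigma -> 0 < tau -> 0 < e < 1 ->
  a + sigma <= c - e -> c + e <= b - tau ->
  phi v * step (- ((1 - e ^+ 3) * (c - a))^-1)
    [:: (a, - ((c - a) * (1 + e * (b - a) ^+ 2))^-1);
        (a + sigma, - ((c - a - sigma) * (1 + e * (b - a) ^+ 2))^-1);
        (c - e, 0);
        (c + e, ((b - c - tau) * (1 + e * (b - a) ^+ 2))^-1);
        (b - tau, ((b - c) * (1 + e * (b - a) ^+ 2))^-1);
        (b, ((1 - e ^+ 3) * (b - c))^-1)] v <=
  phi v * ratio 1 (- c) (penA a b c (e ^+ 3)) (penB a b c (e ^+ 3))
    (penC a b c (e ^+ 3)) v.
Proof.
have [ab1 ac1 cb1] := And3 ab ac cb.
move=> sg0 ta0 e01 o2 o4.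
have [e_gt0 e_lt1] := andP e01.
have hc : a < c < b by rewrite ac cb.
have hth : 0 < e ^+ 3 < 1 by rewrite exprn_gt0// exprn_ilt1// ltW.
have p0 := pen_gt0 ab v hc hth.
have o3' : c <= c + e by rewrite lerDl ltW.
have o5 : b - tau <= b by rewrite gerBl ltW.
rewrite /ratio -/(pen a b c (e ^+ 3) v) mul1r.
have [vc|cv] := leP v c.
  have dv : `|v - c| = c - v by rewrite ler0_norm ?opprB// subr_le0.
  have wE : (v - c) / pen a b c (e ^+ 3) v = - (`|v - c| / pen a b c (e ^+ 3) v).
    by rewrite dv -mulNr opprB.
  rewrite wE; have [va|av] := leP v a.
    rewrite /= va; apply: ler_wpM2l; first exact: density_le_a.
    by rewrite lerN2; apply: center_upper; rewrite ?dv ?subr_gt0// lerD2l lerN2.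
  have vab : a <= v <= b by rewrite (ltW av) (le_trans vc)// ltW.
  have ph : phi v <= 0 by rewrite density_ac// (ltW av).
  have [vs|sv] := leP v (a + sigma).
    rewrite /= (lt_geF av) vs; apply: ler_wnM2l => //.
    by rewrite lerN2; apply: center_lower; rewrite ?dv//; lra.
  have [ve|ev] := leP v (c - e).
    rewrite /= (lt_geF av) (lt_geF sv) ve; apply: ler_wnM2l => //.
    by rewrite lerN2; apply: center_lower; rewrite ?dv//; lra.
  rewrite /= (lt_geF av) (lt_geF sv) (lt_geF ev) (le_trans vc o3') mulr0.
  by rewrite mulr_le0// oppr_le0 divr_ge0// ltW.
have dv : `|v - c| = v - c by rewrite gtr0_norm// subr_gt0.
have av := lt_trans ac1 cv.
have ev : c - e < v by rewrite (le_lt_trans _ cv)// gerBl ltW.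
have sv := le_lt_trans o2 ev.
rewrite /= (lt_geF av) (lt_geF sv) (lt_geF ev) -dv.
have [bv|vb] := ltP b v.
  rewrite (lt_geF (le_lt_trans (le_trans o4 o5) bv)) (lt_geF (le_lt_trans o5 bv)).
  apply: ler_wnM2l; first by rewrite density_ge_b// ltW.
  by apply: center_upper; rewrite ?dv ?subr_gt0// lerD2r ltW.
have vab : a <= v <= b by rewrite (ltW av).
have ph : 0 <= phi v by rewrite density_cb// (ltW cv).
have [vs|sv'] := leP v (c + e).
  by rewrite mulr0 mulr_ge0// divr_ge0// ltW.
have [vt|tv] := leP v (b - tau).
  by apply: ler_wpM2l => //; apply: center_lower; rewrite ?dv//; lra.
by apply: ler_wpM2l => //; apply: center_lower; rewrite ?dv//; lra.
Qed.

(** There is no blow-up at [c], where phi(v) (v - c) vanishes. As e tends to 0, the Abel sum of the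
    lower step function keeps only the jumps at a + sigma and b - tau: those at [a] and [b] close
    up, and f vanishes at [c]. The difference of 1 / (c - a - sigma) and 1 / (c - a), and its
    analogue on the right, produce the quotients of the hypothesis. *)
Lemma inner_end_center sigma tau : 0 < sigma < c - a -> 0 < tau < b - c ->
  K < sigma * f (a + sigma) / ((c - a - sigma) * (c - a))
      + tau * f (b - tau) / ((b - c - tau) * (b - c)) ->
  exists2 th, 0 < th < 1 & 0 < excess a b phi c K c th.
Proof.
have [ab1 ac1 cb1] := And3 ab ac cb.
move=> /andP[sg0 sg1] /andP[ta0 ta1] hK.
pose D := (b - a) ^+ 2.
(* [i1] and [i2] are the bounds of [center_upper] and [center_lower]; both tend to 1 / x. *)
pose i1 x (e : R) := ((1 - e ^+ 3) * x)^-1.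
pose i2 x (e : R) := (x * (1 + e * D))^-1.
pose s e := [:: (a, - i2 (c - a) e); (a + sigma, - i2 (c - a - sigma) e);
  (c - e, 0); (c + e, i2 (b - c - tau) e); (b - tau, i2 (b - c) e); (b, i1 (b - c) e)].
pose G e := step_sum f (- i1 (c - a) e) (s e) - K / (1 - e ^+ 3 * gap a b c).
have e3 : (fun e => e ^+ 3) @ (0 : R) --> (0 : R).
  have : (fun e : R => e ^+ 3) @ (0 : R) --> (0 : R) ^+ 3 by exact: exprn_continuous.
  by rewrite expr0n.
have c1 (x : R) : (fun=> x) @ (0 : R) --> x by exact: cvg_cst.
have I1 x : x != 0 -> (i1 x) @ (0 : R) --> x^-1.
  move=> x0; have -> : x^-1 = ((1 - 0) * x)^-1 by rewrite subr0 mul1r.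
  apply: cvgV; first by rewrite subr0 mul1r.
  by apply: cvgM => //; exact: cvgB.
have I2 x : x != 0 -> (i2 x) @ (0 : R) --> x^-1.
  move=> x0; have -> : x^-1 = (x * (1 + 0 * D))^-1 by rewrite mul0r addr0 mulr1.
  apply: cvgV; first by rewrite mul0r addr0 mulr1.
  by apply: cvgM => //; apply: cvgD => //; apply: cvgM => //; exact: cvg_id.
have p1 : c - a != 0 by rewrite gt_eqF// subr_gt0.
have p2 : c - a - sigma != 0 by rewrite gt_eqF// subr_gt0.
have q1 : b - c != 0 by rewrite gt_eqF// subr_gt0.
have q2 : b - c - tau != 0 by rewrite gt_eqF// subr_gt0.
have [e0 e00 he] : exists2 e : R, 0 < e & forall x, 0 < x < e -> 0 < G x.
  apply: near0.
  have lim : G @ (0 : R) -->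
      ((- (c - a)^-1 - - (c - a)^-1) * f a +
      ((- (c - a)^-1 - - (c - a - sigma)^-1) * f (a + sigma) +
      ((- (c - a - sigma)^-1 - 0) * f c +
      ((0 - (b - c - tau)^-1) * f c +
      (((b - c - tau)^-1 - (b - c)^-1) * f (b - tau) +
      (((b - c)^-1 - (b - c)^-1) * f b + 0)))))) - K / (1 - 0 * gap a b c).
    apply: cvgB; last first.
      apply: cvgM => //; apply: cvgV; first by rewrite mul0r subr0 oner_neq0.
      by apply: cvgB => //; exact: cvgM.
    apply: cvgD.
      by apply: cvgM => //; apply: cvgB; apply: cvgN; [exact: I1|exact: I2].
    apply: cvgD; first by apply: cvgM => //; apply: cvgB; apply: cvgN; exact: I2.
    apply: cvgD.
      by apply: cvgM; [apply: cvgB => //; apply: cvgN; exact: I2|exact: cvg_shiftN].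
    apply: cvgD.
      by apply: cvgM; [apply: cvgB => //; exact: I2|exact: cvg_shift].
    apply: cvgD; first by apply: cvgM => //; apply: cvgB; exact: I2.
    apply: cvgD => //.
    by apply: cvgM => //; apply: cvgB; [exact: I2|exact: I1].
  have := cvgr_gt _ lim; apply.
  rewrite (_ : K / _ = K); last by rewrite mul0r subr0 divr1.
  rewrite subr_gt0 (lt_le_trans hK)// f_c le_eqVlt; apply/orP; left.
  by apply/eqP; field; rewrite p1 p2 q1 q2.
pose e := Num.min (Num.min (e0 / 2) (1 / 2))
                  (Num.min ((c - a - sigma) / 2) ((b - c - tau) / 2)).
have e_gt0 : 0 < e by rewrite !lt_min !divr_gt0// subr_gt0.
have [e1 e2 e4 e5] : [/\ e <= e0 / 2, e <= 1 / 2,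
    e <= (c - a - sigma) / 2 & e <= (b - c - tau) / 2].
  by rewrite /e !ge_min !lexx !orbT.
clearbody e.
have {}he : 0 < G e by apply: he; rewrite e_gt0; lra.
have e01 : 0 < e < 1 by rewrite e_gt0; lra.
have hth : 0 < e ^+ 3 < 1.
  by have [_ le1] := andP e01; rewrite exprn_gt0// exprn_ilt1// ltW.
exists (e ^+ 3) => //.
have hc : a < c < b by rewrite ac cb.
apply: (lt_le_trans he); rewrite /G /excess penA_gap// lerD2r.
have o1 : a <= a + sigma by rewrite lerDl ltW.
have o2 : a + sigma <= c - e by lra.
have o3 : c - e <= c + e by lra.
have o4 : c + e <= b - tau by lra.
have o5 : b - tau <= b by rewrite gerBl ltW.
apply: (step_le_wint phi_int wint_phi_heaviside wint_phi_cst).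
- by rewrite /= o1 o2 o3 o4 o5.
- exact/tame_ratio/posquad_pen.
by move=> v; exact: center_step_le.
Qed.

End two_peaked_density.

(** * The curve of zeros of the excess *)

Section pencil_root.
Context {R : realType}.
Local Notation mu := (@lebesgue_measure R).
Variables (phi : R -> R) (a b c K : R).
Hypothesis phi_int : mu.-integrable setT (EFin \o phi).
Hypothesis phi_cubic : forall v, phi v * ((v - a) * (v - c) * (v - b)) <= 0.
Hypothesis ac : a < c.
Hypothesis cb : c < b.
Hypothesis K0 : 0 < K.
Hypothesis inner : forall m, a < m < b ->
  exists2 th, 0 < th < 1 & 0 < excess a b phi c K m th.
Hypothesis outer : forall m, a < m < b ->
  exists2 th, 0 < th < 1 & excess a b phi c K m th < 0.
Hypothesis left_end : exists2 e, 0 < e & forall m th, a < m < b -> m < a + e ->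
  0 < th < 1 -> penA a b m th * pint a b phi 1 (- a) m th < K.
Hypothesis right_end : exists2 e, 0 < e & forall m th, a < m < b -> b - e < m ->
  0 < th < 1 -> penA a b m th * pint a b phi 1 (- b) m th < K.

Let ab : a < b. Proof. exact: lt_trans cb. Qed.
Local Notation ex := (excess a b phi c K).

Lemma excess_root m : a < m < b -> exists2 th, 0 < th < 1 & ex m th = 0.
Proof.
move=> hm; have [t1 ht1 e1] := inner hm; have [t2 ht2 e2] := outer hm.
have [p1 q1] := andP ht1; have [p2 q2] := andP ht2.
have t12 : t1 <= t2.
  rewrite leNgt; apply/negP => lt.
  have := excess_decr ab phi_int phi_cubic K0 hm ht2 ht1 lt.
  by move=> /(lt_trans e1)/lt_trans/(_ e2); rewrite ltxx.
have [||th] := @IVT R (ex m) t1 t2 0 t12.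
- apply: continuous_in_subspaceT => t; rewrite inE/= in_itv/= => /andP[h1 h2].
  apply: excess_cvg => //; last exact: cvg_cst.
  by rewrite (lt_le_trans p1 h1) (le_lt_trans h2 q2).
- by rewrite ge_min le_max (ltW e1) (ltW e2) orbT.
rewrite in_itv/= => /andP[h1 h2] e0; exists th => //.
by rewrite (lt_le_trans p1 h1) (le_lt_trans h2 q2).
Qed.

(** Strict monotonicity in [th] brackets the root between [t1] and [t2], where the excess has
    opposite signs. By continuity in [m] these signs persist nearby and trap the neighbouring
    roots. *)
Lemma excess_root_cvg (root : R -> R) :
    (forall m, a < m < b -> 0 < root m < 1 /\ ex m (root m) = 0) ->
  forall m, a < m < b -> root @ m --> root m.
Proof.
move=> hroot m hm; have [/andP[r0 r1] er] := hroot m hm.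
have [am mb] := andP hm.
apply/cvgrPdist_lt => e e0.
(* The bracket is within e / 2 of the root and stays inside ]0, 1[. *)
pose t1 := Num.max (root m - e / 2) (root m / 2).
pose t2 := Num.min (root m + e / 2) ((1 + root m) / 2).
have [a1 a2] : root m - e / 2 <= t1 /\ root m / 2 <= t1.
  by rewrite /t1 !le_max !lexx orbT.
have a3 : t1 < root m by rewrite gt_max; apply/andP; split; lra.
have [b1 b2] : t2 <= root m + e / 2 /\ t2 <= (1 + root m) / 2.
  by rewrite /t2 !ge_min !lexx orbT.
have b3 : root m < t2 by rewrite lt_min; apply/andP; split; lra.
have close r : t1 < r -> r < t2 -> `|root m - r| < e.
  move=> t1r rt2; rewrite ltr_norml; clearbody t1 t2.
  by apply/andP; split; lra.
clearbody t1 t2.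
have ht1 : 0 < t1 < 1 by apply/andP; split; lra.
have ht2 : 0 < t2 < 1 by apply/andP; split; lra.
have hr : 0 < root m < 1 by rewrite r0.
have decr x t t' := @excess_decr _ _ _ ab _ phi_int _ _ phi_cubic K0 x t t'.
have E1 : 0 < ex m t1 by rewrite -er; exact: decr.
have E2 : ex m t2 < 0 by rewrite -er; exact: decr.
have C1 : (fun x => ex x t1) @ m --> ex m t1.
  by apply: excess_cvg => //; exact: cvg_cst.
have C2 : (fun x => ex x t2) @ m --> ex m t2.
  by apply: excess_cvg => //; exact: cvg_cst.
have N1 : \forall x \near m, 0 < ex x t1 by have := cvgr_gt _ C1; apply.
have N2 : \forall x \near m, ex x t2 < 0 by have := cvgr_lt _ C2; apply.
have N3 : \forall x \near m, a < x by exact: lt_nbhsr.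
have N4 : \forall x \near m, x < b by exact: lt_nbhsl.
near=> x.
have hx : a < x < b by apply/andP; split; near: x.
have [hrx erx] := hroot x hx.
have l1 : t1 < root x.
  rewrite ltNge; apply/negP; rewrite le_eqVlt => /predU1P[h|h].
    by have : 0 < ex x t1 by [near: x]; rewrite -h erx ltxx.
  have := decr _ _ _ hx hrx ht1 h; rewrite erx ltNge => /negP; apply.
  by apply: ltW; near: x.
have l2 : root x < t2.
  rewrite ltNge; apply/negP; rewrite le_eqVlt => /predU1P[h|h].
    by have : ex x t2 < 0 by [near: x]; rewrite h erx ltxx.
  have := decr _ _ _ hx ht2 hrx h; rewrite erx ltNge => /negP; apply.
  by apply: ltW; near: x.
exact: close.
Unshelve. all: by end_near.
Qed.

(** The excess provides one equation along a continuous curve; the intermediate value theorem for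
    [U], the integral of phi / pen, provides the other. *)
Lemma pencil_root : exists m th, [/\ a < m < b, 0 < th < 1,
  pint a b phi 0 1 m th = 0 & penA a b m th * pint a b phi 1 0 m th = K].
Proof.
have [ab1 ac1 cb1] := And3 ab ac cb.
(* The value 0 outside ]a, b[ is arbitrary. *)
have /boolp.choice[root hroot] : forall m, exists th,
    a < m < b -> 0 < th < 1 /\ ex m th = 0.
  move=> m; have [hm|hm] := boolP (a < m < b); last by exists 0.
  by have [th ? ?] := excess_root hm; exists th.
have rcvg := excess_root_cvg hroot.
pose U m := pint a b phi 0 1 m (root m).
have Uc m : a < m < b -> U @ m --> U m.
  move=> hm; have [hr _] := hroot m hm.
  have [_] := pint_cvg ab phi_int 0 1 hm hr (@cvg_id _ (nbhs m)) (rcvg m hm).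
  exact.
(* A zero of the excess fixes the integral of phi (v - c) / pen, and c - x is the shift to v - x. As
   c - x is positive at [a] and negative at [b], the two end estimates give [U] opposite signs. *)
have UE m x : a < m < b -> penA a b m (root m) * pint a b phi 1 (- x) m (root m) =
    K + penA a b m (root m) * (c - x) * U m.
  move=> hm; have [hr] := hroot m hm.
  have pq := posquad_pen ab hm hr; have [A0 _] := pq.
  move/eqP; rewrite /excess subr_eq0 => /eqP.
  rewrite /U /pint (qintE phi_int 1 (- c) pq) (qintE phi_int 1 (- x) pq) => h.
  have {}h : qint phi 1 0 (penA a b m (root m)) (penB a b m (root m))
      (penC a b m (root m)) = K / penA a b m (root m) +
      c * qint phi 0 1 (penA a b m (root m)) (penB a b m (root m))
      (penC a b m (root m)) by rewrite -h; ring.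
  by rewrite h; field; rewrite gt_eqF.
have [e1 e10 he1] := left_end; have [e2 e20 he2] := right_end.
pose d1 := Num.min (e1 / 2) ((b - a) / 4).
pose d2 := Num.min (e2 / 2) ((b - a) / 4).
have ba : 0 < (b - a) / 4 by lra.
have d10 : 0 < d1 by rewrite lt_min ba divr_gt0.
have d20 : 0 < d2 by rewrite lt_min ba divr_gt0.
have [d1a d1b] : d1 <= e1 / 2 /\ d1 <= (b - a) / 4.
  by rewrite /d1 !ge_min !lexx orbT.
have [d2a d2b] : d2 <= e2 / 2 /\ d2 <= (b - a) / 4.
  by rewrite /d2 !ge_min !lexx orbT.
clearbody d1 d2.
have hm1 : a < a + d1 < b by apply/andP; split; lra.
have hm2 : a < b - d2 < b by apply/andP; split; lra.
have U1 : U (a + d1) <= 0.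
  have [hr _] := hroot _ hm1; have [A0 _] := posquad_pen ab hm1 hr.
  have := he1 _ _ hm1 _ hr; rewrite UE// => /(_ _)/ltW.
  rewrite gerDl pmulr_rle0 ?mulr_gt0 ?subr_gt0//; apply; lra.
have U2 : 0 <= U (b - d2).
  have [hr _] := hroot _ hm2; have [A0 _] := posquad_pen ab hm2 hr.
  have := he2 _ _ hm2 _ hr; rewrite UE// => /(_ _)/ltW.
  rewrite gerDl nmulr_rle0 ?pmulr_rlt0 ?subr_lt0//; apply; lra.
have m12 : a + d1 <= b - d2 by lra.
have [||m] := @IVT R U (a + d1) (b - d2) 0 m12.
- apply: continuous_in_subspaceT => t; rewrite inE/= in_itv/= => /andP[h1 h2].
  by apply: Uc; apply/andP; split; lra.
- by rewrite ge_min le_max U1 U2 orbT.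
rewrite in_itv/= => /andP[h1 h2] Um.
have hm : a < m < b by apply/andP; split; lra.
have [hr _] := hroot m hm.
exists m, (root m); split => //.
(* With [U] zero, the identity at x = 0 is the remaining equation. *)
by have := UE m 0 hm; rewrite Um mulr0 addr0 oppr0.
Qed.

End pencil_root.

(** * From the pencil back to the spectral parameter *)

Unset Implicit Arguments.

Theorem lemma6 (R : realType) (f0 : R -> R) (a b c M k : R)
    (hf0 : regular_profile f0) (hpeaks : two_peaked f0 a b c M)
    (hk : k != 0)
    (hreal : forall s : R, f0^`() s = 0 -> real_dispersion f0^`() k s != 0)
    (hst : exists sigma tau : R,
      [/\ 0 < sigma < c - a,
          0 < tau < b - c &
          sigma * f0 (a + sigma) / ((c - a - sigma) * (c - a))
          + tau * f0 (b - tau) / ((b - c - tau) * (b - c)) > k ^+ 2]) :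
  exists! l : R[i], 0 < complex.Re l /\ Delta f0^`() k l = 0.
Proof.
case: hpeaks => ac cb M0 fa fb fc f'a f'b f'c fpos fneg.
have phi_int := profile'_L1 hf0.
set phi := derive1 f0 in phi_int f'a f'b f'c fpos fneg *.
have phi_cont : continuous phi.
  move=> v; apply: differentiable_continuous; apply/derivable1_diffP.
  exact: profile_derivable2 hf0 v.
have f_cont : continuous f0.
  move=> v; apply: differentiable_continuous; apply/derivable1_diffP.
  exact: profile_derivable hf0 v.
have neg_ac v : a < v < c -> phi v < 0 by move=> h; apply: fneg; left.
have pos_cb v : c < v < b -> 0 < phi v by move=> h; apply: fpos; right.
have pos_a v : v < a -> 0 < phi v by move=> h; apply: fpos; left.
have neg_b v : b < v -> phi v < 0 by move=> h; apply: fneg; right.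
have prim := wint_heaviside (profile_derivable hf0) phi_cont
  (profile_cvgNy hf0) phi_int.
have total := wint_cst (profile_derivable hf0) phi_cont
  (profile_cvgNy hf0) (profile_cvgy hf0) phi_int.
have fab : f0 a = f0 b by rewrite fa.
have K0 : 0 < k ^+ 2 by rewrite exprn_even_gt0.
have cubic := density_cubic ac cb neg_ac pos_cb pos_a neg_b f'a f'b f'c.
have ab := lt_trans ac cb.
have [m [th [hm hth U0 W1]]] : exists m th, [/\ a < m < b, 0 < th < 1,
    pint a b phi 0 1 m th = 0 & penA a b m th * pint a b phi 1 0 m th = k ^+ 2].
  apply: (@pencil_root R phi a b c) => //.
  - move=> m hm; have [->|mc] := eqVneq m c; last exact: inner_end_noncenter.
    have [sigma [tau [hs ht hK]]] := hst.
    exact: (inner_end_center phi_int ac cb neg_ac pos_cb pos_a neg_b f'a f'b f'c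
      prim total f_cont fc hs ht hK).
  - by move=> m hm; exact: outer_end.
  - exact: (near_left phi_int ac cb neg_ac pos_cb pos_a neg_b f'a f'b f'c K0
      prim total f_cont fab).
  - exact: (near_right phi_int ac cb neg_ac pos_cb pos_a neg_b f'a f'b f'c K0
      prim total f_cont fab).
have pq := posquad_pen ab hm hth; have [A0 D0] := pq.
set A := penA a b m th in A0 D0 pq W1; set B := penB a b m th in D0 pq.
set C := penC a b m th in D0 pq.
(* Rescaling gives the leading coefficient k^2. Then [y] is read off the linear coefficient and [x]
   off the constant one, as in the quadratic x^2 + (k v + y)^2. *)
pose s := k ^+ 2 / A; have s0 : 0 < s by rewrite divr_gt0.
have sA : s * A = k ^+ 2 by rewrite /s divfK// gt_eqF.
pose y := s * B / (2 * k); pose x := Num.sqrt (s * C - y ^+ 2).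
have yE : 2 * k * y = s * B by rewrite /y; field.
(* Times 4 k^2, this is s^2 times minus the discriminant of the pencil member. *)
have x2 : 0 < s * C - y ^+ 2.
  rewrite -(pmulr_rgt0 _ (_ : 0 < 4 * (s * A))); last by rewrite sA mulr_gt0.
  rewrite mulrBr {2}sA (_ : 4 * k ^+ 2 * y ^+ 2 = (2 * k * y) ^+ 2); last by ring.
  rewrite yE (_ : _ - _ = s ^+ 2 * (4 * A * C - B ^+ 2)); last by ring.
  by rewrite mulr_gt0 ?exprn_gt0// subr_gt0.
have x0 : 0 < x by rewrite sqrtr_gt0.
have xE : x ^+ 2 + y ^+ 2 = s * C by rewrite sqr_sqrtr ?subrK// ltW.
have U1 : qint phi 0 1 (k ^+ 2) (2 * k * y) (x ^+ 2 + y ^+ 2) = 0.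
  by rewrite yE xE -sA (qint_scale phi_int) ?gt_eqF// -/(pint a b phi 0 1 m th) U0 mulr0.
have V1 : qint phi 1 0 (k ^+ 2) (2 * k * y) (x ^+ 2 + y ^+ 2) = 1.
  rewrite yE xE -sA (qint_scale phi_int) ?gt_eqF// -/(pint a b phi 1 0 m th).
  (* The rescaling divides the integral by [s], and [W1] says that the integral equals k^2 / A,
     which is [s]. *)
  have -> : pint a b phi 1 0 m th = s by rewrite /s -W1 mulrC mulKf// gt_eqF.
  by rewrite mulVf// gt_eqF.
exists (x +i* y); split; first by split => //; apply/Delta_eq0.
case=> x' y' /= [x'0 /(Delta_eq0 phi_int _ hk x'0)[U2 V2]].
have [By Cx] := quadratic_unique phi_int cubic
  (dispersion_posquad y hk x0) (dispersion_posquad y' hk x'0) U1 V1 U2 V2.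
have yy : y = y' by apply: (mulfI (_ : 2 * k != 0)); rewrite ?mulf_neq0.
rewrite -yy in Cx *; congr (_ +i* _).
by apply/eqP; rewrite -(eqrXn2 (n := 2)) ?ltW//; apply/eqP/(addIr (y ^+ 2)).
Qed.
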